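(* Let $\Omega\subset\mathbb{R}^n$ be a nonempty open bounded convex set satisfying an interior sphere condition, and let $a$ be a real constant. Assume that the unique solution of the Dirichlet problem $-\Delta_\infty u=1$ in $\Omega$, $u=0$ on $\partial\Omega$, is of class $C^1$ on $\{x\in\overline\Omega:\operatorname{dist}(x,\partial\Omega)<\delta\}$ for some $\delta>0$, that there exists an inner ball $B\subset\Omega$ of radius $\rho_\Omega$ whose boundary meets $\partial\Omega$ at two points lying on the same diameter of $B$, and that the overdetermined boundary value problem $$-\Delta_\infty u=1\ \text{in }\Omega,\qquad u=0\ \text{on }\partial\Omega,\qquad|\nabla u|=a\ \text{on }\partial\Omega$$ admits a solution. Then: (i) if $\Omega$ is of class $C^2$, then $\Omega$ is a ball; (ii) if $n=2$, the set $S:=\overline\Sigma(\Omega)=\mathrm M(\Omega)$ is a line segment (possibly degenerated into a point), and $\Omega$ is the stadium-like domain $\Omega=\{x\in\mathbb{R}^2:\operatorname{dist}(x,S)<\rho_\Omega\}$.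
   Context: For smooth $\varphi$, $\Delta_\infty\varphi:=\langle\nabla^2\varphi\,\nabla\varphi,\nabla\varphi\rangle$. A solution to the Dirichlet problem is a function $u\in C(\overline\Omega)$ with $u=0$ on $\partial\Omega$ which is a viscosity solution of $-\Delta_\infty u=1$ in $\Omega$, i.e. for every $x_0\in\Omega$ and $\varphi\in C^2(\Omega)$: if $u-\varphi$ has a local maximum at $x_0$ then $-\Delta_\infty\varphi(x_0)-1\le 0$, and if $u-\varphi$ has a local minimum at $x_0$ then $-\Delta_\infty\varphi(x_0)-1\ge 0$. The solution is known to exist and be unique. The overdetermined problem admits a solution if this unique solution $u$ is of class $C^1$ up to the boundary near $\partial\Omega$ (in the sense stated in the claim) and $|\nabla u|=a$ on $\partial\Omega$. Interior sphere condition: every point of $\partial\Omega$ lies on the boundary of some open ball contained in $\Omega$. $d_{\partial\Omega}$ is the distance to $\partial\Omega$; $\rho_\Omega:=\max_{\overline\Omega}d_{\partial\Omega}$ is the inradius. $\Sigma(\Omega)$ is the set of points of $\Omega$ where $d_{\partial\Omega}$ is not differentiable; the cut locus $\overline\Sigma(\Omega)$ is the closure of $\Sigma(\Omega)$ in $\overline\Omega$; the high ridge is $\mathrm M(\Omega):=\{x\in\Omega:d_{\partial\Omega}(x)=\rho_\Omega\}$. (Under the stated hypotheses cut locus and high ridge coincide.) *)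

(* Defs.v *)
From HB Require Import structures.
From mathcomp Require Import all_boot all_order all_algebra.
From mathcomp Require Import all_classical all_reals all_analysis.
Set Implicit Arguments.
Unset Strict Implicit.
Unset Printing Implicit Defensive.
Import Order.TTheory GRing.Theory Num.Theory.
Import numFieldNormedType.Exports.

Local Open Scope classical_set_scope.
Local Open Scope ring_scope.

Section Euclidean.
Context {R : realType} {n : nat}.
Implicit Types (x y p q c : 'rV[R]_n) (A : set 'rV[R]_n).

Definition dot x y : R := \sum_i x 0 i * y 0 i.

(* The library norm on row vectors is the sup norm. It induces the same
   topology and the same bounded sets, but balls, distances and lengths of
   gradients below must be Euclidean. *)
Definition enorm x : R := Num.sqrt (dot x x).

Definition eball c (r : R) : set 'rV[R]_n := [set x | enorm (x - c) < r].

Definition dist_to x A : R := inf [set enorm (x - y) | y in A].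

Definition bdry A : set 'rV[R]_n := closure A `\` A°.

Definition line_segment p q : set 'rV[R]_n :=
  [set p + t *: (q - p) | t in [set t : R | 0 <= t <= 1]].

End Euclidean.

Section Calculus.
Context {R : realType} {n : nat}.
Implicit Types (f : 'rV[R]_n -> R) (U : set 'rV[R]_n) (x : 'rV[R]_n).

Definition partial (i : 'I_n) f x : R := 'D_(delta_mx 0 i) f x.

Definition gradient f x : 'rV[R]_n := \row_i partial i f x.

Definition hessian f x : 'M[R]_n := \matrix_(i, j) partial i (partial j f) x.

(* C1_on and C2_on are meant for open U. *)
Definition C1_on U f : Prop :=
  forall i x, U x ->
    derivable f x (delta_mx 0 i) /\ {for x, continuous (partial i f)}.

Definition C2_on U f : Prop :=
  C1_on U f /\ forall i, C1_on U (partial i f).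

(* Row vectors: the matrix hessian f x acts on the gradient as v |-> v H^T. *)
Definition infinity_laplacian f x : R :=
  dot (gradient f x *m (hessian f x)^T) (gradient f x).

End Calculus.

Section Problem.
Context {R : realType} {n : nat}.
Implicit Types (Omega : set 'rV[R]_n) (u : 'rV[R]_n -> R).

(* Functions on Omega or on its closure are total functions on R^n; their
   values elsewhere are irrelevant. In the next two definitions, since Omega is
   open, a neighbourhood of x0 in Omega is a neighbourhood of x0 in R^n. *)
Definition viscosity_subsolution Omega u : Prop :=
  forall (x0 : 'rV[R]_n) (phi : 'rV[R]_n -> R), Omega x0 -> C2_on Omega phi ->
    (\forall x \near x0, u x - phi x <= u x0 - phi x0) ->
    - infinity_laplacian phi x0 - 1 <= 0.

Definition viscosity_supersolution Omega u : Prop :=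
  forall (x0 : 'rV[R]_n) (phi : 'rV[R]_n -> R), Omega x0 -> C2_on Omega phi ->
    (\forall x \near x0, u x0 - phi x0 <= u x - phi x) ->
    - infinity_laplacian phi x0 - 1 >= 0.

Definition dirichlet_solution Omega u : Prop :=
  [/\ {within closure Omega, continuous u},
      (forall x, bdry Omega x -> u x = 0),
      viscosity_subsolution Omega u
    & viscosity_supersolution Omega u].

Definition bdry_dist Omega (x : 'rV[R]_n) : R := dist_to x (bdry Omega).

Definition bdry_layer Omega (delta : R) : set 'rV[R]_n :=
  [set x | closure Omega x /\ bdry_dist Omega x < delta].

(* u is C^1 on the layer, up to the boundary, with gradient G: u has partial
   derivatives at the interior points of the layer, and its gradient there is
   the restriction of a function G that is continuous on the whole layer. For
   open Omega this determines G on the layer, whose interior points are dense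
   in it; at a boundary point x, the gradient of u is by definition G x. *)
Definition C1_up_to_bdry Omega (delta : R) u (G : 'rV[R]_n -> 'rV[R]_n)
    : Prop :=
  {within bdry_layer Omega delta, continuous G} /\
  forall x, bdry_layer Omega delta x -> Omega x ->
    (forall i, derivable u x (delta_mx 0 i)) /\ gradient u x = G x.

Definition interior_sphere_condition Omega : Prop :=
  forall x, bdry Omega x ->
    exists (c : 'rV[R]_n) (r : R),
      [/\ 0 < r, eball c r `<=` Omega & bdry (eball c r) x].

(* For bounded Omega the supremum is attained. *)
Definition inradius Omega : R :=
  sup [set bdry_dist Omega x | x in closure Omega].

(* The diameters of the ball of center c and radius r are the segments
   [c - w, c + w] with |w| = r. *)
Definition touches_at_diameter Omega (c : 'rV[R]_n) (r : R) : Prop :=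
  exists p q w : 'rV[R]_n,
    [/\ p != q,
        (bdry (eball c r) `&` bdry Omega) p,
        (bdry (eball c r) `&` bdry Omega) q,
        enorm w = r
      & line_segment (c - w) (c + w) p /\ line_segment (c - w) (c + w) q].

Definition singular_set Omega : set 'rV[R]_n :=
  [set x | Omega x /\ ~ differentiable (bdry_dist Omega) x].

(* The closure in R^n, which is also the closure in closure Omega. *)
Definition cut_locus Omega : set 'rV[R]_n := closure (singular_set Omega).

Definition high_ridge Omega : set 'rV[R]_n :=
  [set x | Omega x /\ bdry_dist Omega x = inradius Omega].

(* Near each boundary point, Omega is the strict epigraph or hypograph, in the
   direction of some coordinate axis i, of a C^2 function of the other n - 1
   coordinates; col' i x is x with its i-th coordinate removed. *)
Definition C2_domain Omega : Prop :=
  forall x0, bdry Omega x0 ->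
    exists (r : R) (i : 'I_n) (s : bool) (g : 'rV[R]_n.-1 -> R),
      [/\ 0 < r, C2_on setT g
        & forall x, eball x0 r x ->
            (Omega x <-> g (col' i x) < (-1) ^+ s * x 0 i)].

Definition is_open_ball Omega : Prop :=
  exists (c : 'rV[R]_n) (r : R), 0 < r /\ Omega = eball c r.

End Problem.

(* Main.v *)
(* Let rho be the inradius, d the distance to the boundary and M the set of
   maximum points of d.  For m ^ 3 > 81/64 r ^ 4 the radial profile
   m (1 - (1 - s/r)^(4/3)) is a strict supersolution off its center; centered at
   a boundary point y, where u = 0, it dominates u as soon as u <= m on the ball
   of radius r around y.  This yields two facts, without any concavity or
   interior C^1 regularity of u:
   - (max u)^3 <= 81/64 d(x)^4 at every maximum point x of u;
   - if u <= m on the ball of radius r around y, then a <= 4 m / (3 r).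
   A radial strict subsolution in the inner ball gives a^3 >= 3 rho at a
   touching point.  Hence the ball of radius rho around any boundary point y
   contains a maximum point z of u, and d(z) = rho: every boundary point is
   within rho of M.  By convexity Omega is the set of points at distance less
   than rho from M, and d = rho - dist(., M) is differentiable exactly off M.
   The two antipodal touching points put M in a hyperplane, so M is a segment
   when n = 2.  If M is not a point, take z in M farthest from c: near the
   boundary point above z the boundary is flat on one side and below a parabola
   on the other, so it is not C^2. *)
Require Import Defs.
From HB Require Import structures.
From mathcomp Require Import all_boot all_order all_algebra.
From mathcomp Require Import ring lra.
From mathcomp Require Import all_classical all_reals all_analysis.
Set Implicit Arguments.
Unset Strict Implicit.
Unset Printing Implicit Defensive.
Import Order.TTheory GRing.Theory Num.Theory.
Import numFieldNormedType.Exports.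
Local Open Scope classical_set_scope.
Local Open Scope ring_scope.

(** * Euclidean geometry of row vectors *)

Section EuclideanTheory.
Context {R : realType} {n : nat}.
Implicit Types (x y z p q c v w : 'rV[R]_n) (A : set 'rV[R]_n) (k r : R).

(** For a radial function h(|x - y|) the infinity Laplacian is h'^2 h'', so the barriers solve a
    one-dimensional problem. The exact solution on a ball of radius r has height m with m^3 = 81/64
    r^4 and boundary slope 4 m / (3 r), whose cube is 3 r. The bounds on the slope from below, on
    the slope from above and on the maximum of u are therefore all sharp at the same radius rho, and
    their chain closes only with equality; this is what forces a maximum point of u near every
    boundary point. The obstacle is that u is a mere viscosity solution, and no comparison principle
    between two such solutions is invoked. Every comparison is made with an explicit strict barrier
    at one contact point; a center on the boundary is outside the open set Omega, so the tip of the
    profile is never that point. The sharp constants are then reached by slight changes of radius or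
    height. The interior sphere makes the boundary gradient normal, so that a barrier bound in a
    single direction controls its whole length a. *)

Lemma dotC x y : dot x y = dot y x.
Proof. by apply: eq_bigr => i _; rewrite mulrC. Qed.

Lemma dotDl x y z : dot (x + y) z = dot x z + dot y z.
Proof. by rewrite /dot -big_split; apply: eq_bigr => i _; rewrite mxE mulrDl. Qed.

Lemma dotZl k x y : dot (k *: x) y = k * dot x y.
Proof. by rewrite /dot mulr_sumr; apply: eq_bigr => i _; rewrite mxE mulrA. Qed.

Lemma dotNl x y : dot (- x) y = - dot x y.
Proof. by rewrite -scaleN1r dotZl mulN1r. Qed.

Lemma dotBl x y z : dot (x - y) z = dot x z - dot y z.
Proof. by rewrite dotDl dotNl. Qed.

Lemma dotDr x y z : dot x (y + z) = dot x y + dot x z.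
Proof. by rewrite dotC dotDl !(dotC x). Qed.

Lemma dotZr k x y : dot x (k *: y) = k * dot x y.
Proof. by rewrite dotC dotZl dotC. Qed.

Lemma dotNr x y : dot x (- y) = - dot x y.
Proof. by rewrite dotC dotNl dotC. Qed.

Lemma dotBr x y z : dot x (y - z) = dot x y - dot x z.
Proof. by rewrite dotDr dotNr. Qed.

Lemma dot0l x : dot 0 x = 0.
Proof. by rewrite -(scale0r x) dotZl mul0r. Qed.

Lemma dot0r x : dot x 0 = 0.
Proof. by rewrite dotC dot0l. Qed.

Lemma dot_ge0 x : 0 <= dot x x.
Proof. by apply: sumr_ge0 => i _; rewrite -expr2 sqr_ge0. Qed.

Lemma dot_eq0 x : (dot x x == 0) = (x == 0).
Proof.
apply/eqP/eqP => [x0|->]; last exact: dot0l.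
apply/rowP => i; rewrite mxE; apply/eqP; rewrite -sqrf_eq0 expr2.
move/eqP: x0; rewrite /dot psumr_eq0 => [/allP/(_ i)|j _]; last by rewrite -expr2 sqr_ge0.
by rewrite mem_index_enum => /(_ isT).
Qed.

Lemma dot_delta x (i : 'I_n) : dot x (delta_mx 0 i) = x 0 i.
Proof.
rewrite /dot (bigD1 i) //= mxE !eqxx mulr1 big1 ?addr0 // => j ji.
by rewrite mxE (negPf ji) andbF mulr0.
Qed.

Lemma enorm_ge0 x : 0 <= enorm x.
Proof. exact: sqrtr_ge0. Qed.
#[local] Hint Resolve enorm_ge0 : core.

Lemma enorm_sqr x : enorm x ^+ 2 = dot x x.
Proof. by rewrite sqr_sqrtr // dot_ge0. Qed.

Lemma enorm_eq0 x : (enorm x == 0) = (x == 0).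
Proof. by rewrite -dot_eq0 -enorm_sqr sqrf_eq0. Qed.

Lemma enorm0 : enorm (0 : 'rV[R]_n) = 0.
Proof. by apply/eqP; rewrite enorm_eq0. Qed.

Lemma enorm_gt0 x : (0 < enorm x) = (x != 0).
Proof. by rewrite lt_neqAle enorm_ge0 andbT eq_sym enorm_eq0. Qed.

Lemma enormZ k x : enorm (k *: x) = `|k| * enorm x.
Proof. by rewrite /enorm dotZl dotZr mulrA -expr2 sqrtrM ?sqr_ge0 // sqrtr_sqr. Qed.

Lemma enormN x : enorm (- x) = enorm x.
Proof. by rewrite -scaleN1r enormZ normrN1 mul1r. Qed.

Lemma enormB x y : enorm (x - y) = enorm (y - x).
Proof. by rewrite -enormN opprB. Qed.

Lemma dot_le x y : dot x y <= enorm x * enorm y.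
Proof.
have [->|y0] := eqVneq y 0; first by rewrite dot0r enorm0 mulr0.
have [->|x0] := eqVneq x 0; first by rewrite dot0l enorm0 mul0r.
have yp : 0 < enorm y by rewrite enorm_gt0.
have xp : 0 < enorm x by rewrite enorm_gt0.
(* The square of this vector is [2 * enorm x * enorm y] times the defect in the Cauchy-Schwarz
   inequality. *)
have := dot_ge0 (enorm y *: x - enorm x *: y).
rewrite dotBl !dotBr !dotZl !dotZr -!enorm_sqr (dotC y x) => h.
have xy := mulr_gt0 xp yp.
rewrite -(ler_pM2l xy).
set a := enorm x in h *; set b := enorm y in h *; set d := dot x y in h *; nra.
Qed.

Lemma normr_dot_le x y : `|dot x y| <= enorm x * enorm y.
Proof. by rewrite ler_norml dot_le lerNl -dotNl -(enormN x) dot_le. Qed.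

Lemma enormD x y : enorm (x + y) <= enorm x + enorm y.
Proof.
rewrite -(@ler_pXn2r _ 2) ?nnegrE ?addr_ge0 // enorm_sqr dotDl !dotDr (dotC y x).
rewrite sqrrD !enorm_sqr; have := dot_le x y; lra.
Qed.

Lemma enorm_triangle y x z : enorm (x - z) <= enorm (x - y) + enorm (y - z).
Proof. by rewrite -[x - z](subrKA y) enormD. Qed.

Lemma enorm_sub x y : enorm x - enorm y <= enorm (x - y).
Proof. by rewrite lerBlDr -{1}(subrK y x) enormD. Qed.

Lemma enormD_sqr x y :
  enorm (x + y) ^+ 2 = enorm x ^+ 2 + 2 * dot x y + enorm y ^+ 2.
Proof. by rewrite !enorm_sqr dotDl !dotDr (dotC y x); ring. Qed.

Lemma normr_coord_le x (i : 'I_n) : `|x 0 i| <= `|x|.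
Proof.
have /mapP[j Hj ->] : `|x 0 i| \in [seq `|x k.1 k.2| | k : 'I_1 * 'I_n].
  by apply/mapP; exists (ord0, i) => //=; rewrite mem_enum.
by rewrite [leRHS]/Num.norm /= mx_normrE; apply/bigmax_geP; right => /=; exists j.
Qed.

Lemma normr_le_coord x k : 0 <= k -> (forall i, `|x 0 i| <= k) -> `|x| <= k.
Proof.
move=> k0 xk; rewrite [leLHS]/Num.norm /= mx_normrE.
by apply/bigmax_leP; split=> //= -[i j] _ /=; rewrite ord1.
Qed.

Lemma normr_le_enorm x : `|x| <= enorm x.
Proof.
rewrite [leLHS]/Num.norm /= mx_normrE; apply/bigmax_leP; split=> //= -[i j] _ /=.
rewrite ord1 -(@ler_pXn2r _ 2) ?nnegrE // enorm_sqr real_normK ?num_real //.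
rewrite /dot (bigD1 j) //= expr2 lerDl.
by apply: sumr_ge0 => k _; rewrite -expr2 sqr_ge0.
Qed.

Lemma enorm_le_normr x : enorm x <= n%:R * `|x|.
Proof.
rewrite -(@ler_pXn2r _ 2) ?nnegrE ?mulr_ge0 // enorm_sqr /dot.
apply: (@le_trans _ _ (\sum_(i < n) `|x| ^+ 2)).
  apply: ler_sum => i _; rewrite -expr2 -real_normK ?num_real //.
  by rewrite ler_pXn2r ?nnegrE // normr_coord_le.
rewrite sumr_const card_ord -[leLHS]mulr_natl exprMn ler_wpM2r ?sqr_ge0 //.
by rewrite expr2 -natrM ler_nat; case: (n) => // m; rewrite leq_pmulr.
Qed.

(** The topology is that of the sup norm, and the two norms bound each other up to the factor [n].
    Dividing by [n.+1] covers [n = 0] as well. *)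
Lemma nbhs_eball x (P : set 'rV[R]_n) :
  nbhs x P <-> exists2 e : R, 0 < e & forall y, enorm (y - x) < e -> P y.
Proof.
split => [/nbhs_ballP[e /= e0 eP]|[e e0 eP]].
  exists e => // y yx; apply: eP; rewrite -ball_normE /ball_ /=.
  by rewrite distrC (le_lt_trans (normr_le_enorm _)).
apply/nbhs_ballP; exists (e / n.+1%:R) => [/=|y /= xy]; first by rewrite divr_gt0.
apply: eP; rewrite (le_lt_trans (enorm_le_normr _)) //.
move: xy; rewrite -ball_normE /ball_ /= distrC ltr_pdivlMr // mulrC => /(le_lt_trans _) -> //.
by rewrite ler_wpM2r // ler_nat.
Qed.

Lemma open_eballP A :
  open A <-> forall x, A x -> exists2 e : R, 0 < e & eball x e `<=` A.
Proof.
split => [oA x Ax|h].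
  by have /nbhs_eball[e e0 eA] := open_nbhs_nbhs (conj oA Ax); exists e.
by rewrite openE => x /h[e e0 eA]; apply/nbhs_eball; exists e.
Qed.

Lemma closure_eballP A x :
  closure A x <-> forall e : R, 0 < e -> exists2 y, A y & enorm (y - x) < e.
Proof.
split => [cAx e e0|h B /nbhs_eball[e e0 eB]].
  have [|y [Ay yx]] := cAx (eball x e); last by exists y.
  by apply/nbhs_eball; exists e.
by have [y Ay yx] := h e e0; exists y; split=> //; exact: eB.
Qed.

Lemma continuous_eballP (f : 'rV[R]_n -> R) x :
  {for x, continuous f} <->
  forall e : R, 0 < e ->
    exists2 d : R, 0 < d & forall y, enorm (y - x) < d -> `|f y - f x| < e.
Proof.
split => [cf e e0|h].
  move/cvgrPdist_lt : cf => /(_ _ e0)/nbhs_eball[d d0 hd].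
  by exists d => // y /hd; rewrite distrC.
apply/(@cvgrPdist_lt _ R^o _ (nbhs x) _ f (f x)) => e /h[d d0 hd].
apply/nbhs_eball; exists d => // y /hd.
by rewrite distrC.
Qed.

Lemma continuous_lipschitz (f : 'rV[R]_n -> R) k :
  (forall x y, f x - f y <= k * enorm (x - y)) -> continuous f.
Proof.
move=> fk x; apply/continuous_eballP => e e0.
have k1 : 0 < `|k| + 1 by rewrite ltr_wpDl.
exists (e / (`|k| + 1)); first by rewrite divr_gt0.
move=> y; rewrite ltr_pdivlMr // => yx.
apply: le_lt_trans yx; rewrite ler_norml lerNl opprB.
apply/andP; split.
  apply: (le_trans (fk _ _)); rewrite enormB mulrC ler_wpM2l //.
  by rewrite (le_trans (ler_norm _)) // lerDl.
apply: (le_trans (fk _ _)); rewrite mulrC ler_wpM2l //.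
by rewrite (le_trans (ler_norm _)) // lerDl.
Qed.

Lemma continuous_enorm_sub y : continuous (fun x => enorm (x - y)).
Proof.
apply: (@continuous_lipschitz _ 1) => x z; rewrite mul1r.
by rewrite lerBlDr -{1}(subrK z x) -addrA enormD.
Qed.

Lemma continuous_dotl w : continuous (fun x => dot x w).
Proof.
apply: (@continuous_lipschitz _ (enorm w)) => x y.
by rewrite -dotBl mulrC dot_le.
Qed.

Lemma bounded_enormP A :
  bounded_set A <-> exists M, forall x, A x -> enorm x <= M.
Proof.
split=> [[M [Mr hM]]|[M hM]].
  exists (n%:R * (M + 1)) => x Ax; rewrite (le_trans (enorm_le_normr x)) //.
  by rewrite ler_wpM2l // (hM (M + 1)) // ltrDl.
exists M; split; first exact: num_real.
move=> M' MM' x Ax /=; rewrite (le_trans (normr_le_enorm x)) //.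
by rewrite (le_trans (hM _ Ax)) // ltW.
Qed.

Lemma bdry_eball c r x : bdry (eball c r) x -> enorm (x - c) = r.
Proof.
move=> [/closure_eballP clx nix]; apply/eqP; rewrite eq_le; apply/andP; split.
  apply/ler_addgt0Pl => e e0; have [y yc yx] := clx e e0.
  rewrite (le_trans (enorm_triangle y _ _)) // lerD //; last exact: ltW.
  by rewrite enormB ltW.
rewrite leNgt; apply/negP => xr; apply: nix.
apply/nbhs_eball; exists (r - enorm (x - c)); first by rewrite subr_gt0.
move=> y yx; rewrite /eball /= (le_lt_trans (enorm_triangle x _ _)) //.
by rewrite -ltrBrDr.
Qed.

End EuclideanTheory.
#[export] Hint Extern 0 (is_true (_ <= enorm _)) => exact: enorm_ge0 : core.

(** * Taylor expansions and strict differentiability *)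

Section OneVariable.
Context {R : realType}.
Implicit Types (h : R -> R) (r t b e : R).

Lemma is_deriveP h r b :
  is_derive r 1 h b <->
  forall e : R, 0 < e -> exists2 d : R, 0 < d &
    forall t, `|t - r| < d -> `|h t - h r - b * (t - r)| <= e * `|t - r|.
Proof.
split.
  move=> [dh hb] e e0.
  have /cvgrPdist_lt/(_ _ e0) : h0^-1 *: (h (h0 *: 1 + r) - h r) @[h0 --> 0^'] --> b.
    by rewrite -hb; exact: dh.
  rewrite near_withinE => /nbhs_ballP[d /= d0 hd]; exists d => // t td.
  have [->|tr] := eqVneq t r; first by rewrite !subrr mulr0 subrr normr0 mulr0.
  have tr0 : t - r != 0 by rewrite subr_eq0.
  have := hd (t - r); rewrite -ball_normE /ball_ /= sub0r normrN => /(_ td tr0).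
  rewrite [_ *: 1]mulr1 subrK => /ltW.
  rewrite -(@ler_pM2r _ `|t - r|) ?normr_gt0 // -normrM => /(le_trans _) -> //.
  rewrite mulrBl [_ *: _]mulrC -mulrA mulVf // mulr1 distrC lexx //.
move=> H.
have cv : h0^-1 *: (h (h0 *: 1 + r) - h r) @[h0 --> 0^'] --> b.
  apply/cvgrPdist_le => e /H[d d0 hd]; rewrite near_withinE.
  apply/nbhs_ballP; exists d => //= k; rewrite -ball_normE /ball_ /= sub0r normrN => kd k0.
  have := hd (k + r); rewrite addrK => /(_ kd).
  rewrite -(@ler_pM2r _ `|k|^-1) ?invr_gt0 ?normr_gt0 // mulfK ?normr_eq0 //.
  rewrite -normfV -normrM [k *: 1]mulr1 => /(le_trans _) -> //.
  by rewrite mulrBl mulfK // [_ *: _]mulrC distrC.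
by apply: DeriveDef; [apply/cvg_ex; exists b | exact: cvg_lim].
Qed.

Lemma is_derive_continuous h r b : is_derive r 1 h b -> {for r, continuous h}.
Proof. by move=> [/derivable1_diffP/differentiable_continuous]. Qed.

(** No order between [r] and [t] is assumed, and the intermediate point is located only by its
    distance to [r], which is all that local estimates ask for. *)
Lemma mvt_sym h h1 r t :
  (forall s, `|s - r| <= `|t - r| -> is_derive s 1 h (h1 s)) ->
  exists2 s, `|s - r| <= `|t - r| & h t - h r = h1 s * (t - r).
Proof.
move=> dh.
have [tr|rt|->] := ltgtP t r; last first.
- by exists r => //; rewrite !subrr mulr0.
- have abs s : s \in `[r, t] -> `|s - r| <= `|t - r|.
    by rewrite in_itv /= => /andP[rs st]; rewrite !ger0_norm ?lerD2r // subr_ge0 // ltW.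
  have [||s sI ->] := @MVT _ h h1 r t rt.
  + by move=> s sI; apply: dh; apply: abs; rewrite in_itv /= !ltW ?(itvP sI).
  + apply: derivable_within_continuous => s sI.
    by have /dh[] := abs _ sI.
  by exists s => //; apply: abs; rewrite in_itv /= !ltW ?(itvP sI).
- have abs s : s \in `[t, r] -> `|s - r| <= `|t - r|.
    rewrite in_itv /= => /andP[ts sr]; rewrite !ler0_norm ?subr_le0 ?(ltW tr) //.
    by rewrite lerN2 lerD2r.
  have [||s sI] := @MVT _ h h1 t r tr.
  + by move=> s sI; apply: dh; apply: abs; rewrite in_itv /= !ltW ?(itvP sI).
  + apply: derivable_within_continuous => s sI.
    by have /dh[] := abs _ sI.
  move=> e; exists s; first by apply: abs; rewrite in_itv /= !ltW ?(itvP sI).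
  by rewrite -opprB e -mulrN opprB.
Qed.

(** Peano form: [h1] is differentiable at the single point [r]. The function [h] minus its quadratic
    polynomial has a derivative that is small compared with [t - r], and the mean value theorem
    supplies the second factor. *)
Lemma taylor2 h h1 r b :
  (\forall s \near r, is_derive (s : R) 1 h (h1 s)) -> is_derive r 1 h1 b ->
  forall e : R, 0 < e -> exists2 d : R, 0 < d & forall t, `|t - r| < d ->
    `|h t - h r - h1 r * (t - r) - b / 2 * (t - r) ^+ 2| <= e * (t - r) ^+ 2.
Proof.
move=> /nbhs_ballP[d1 /= d10 dh] /is_deriveP dh1 e e0.
have [d2 d20 hd2] := dh1 _ e0.
exists (Num.min d1 d2); first by rewrite lt_min d10.
move=> t; rewrite lt_min => /andP[td1 td2].
pose k s := h s - h1 r * (s - r) - b / 2 * (s - r) ^+ 2.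
have [|s sr ks] := @mvt_sym k (fun s => h1 s - h1 r - b * (s - r)) r t.
  move=> s sr.
  have dhs : is_derive s 1 h (h1 s).
    by apply: dh; rewrite -ball_normE /ball_ /= distrC (le_lt_trans sr).
  rewrite /k; apply: is_derive_eq; rewrite /GRing.scale /=.
  by field.
have -> : h t - h r - h1 r * (t - r) - b / 2 * (t - r) ^+ 2 = k t - k r.
  by rewrite /k subrr mulr0 expr0n mulr0 !subr0; ring.
rewrite ks normrM -(real_normK (num_real (t - r))) expr2 mulrA ler_wpM2r //.
by rewrite (le_trans (hd2 _ (le_lt_trans sr td2))) // ler_wpM2l // ltW.
Qed.

End OneVariable.

Section Lines.
Context {R : realType} {n : nat}.
Implicit Types (f : 'rV[R]_n -> R) (U : set 'rV[R]_n) (x y z v : 'rV[R]_n).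

Lemma is_derive_lineP f x v (t b : R) :
  is_derive t 1 (fun s : R => f (s *: v + x)) b <-> is_derive (t *: v + x) v f b.
Proof.
have E : (fun h : R => h^-1 *: (f ((h *: 1 + t) *: v + x) - f (t *: v + x))) =
         (fun h : R => h^-1 *: (f (h *: v + (t *: v + x)) - f (t *: v + x))).
  by apply/funext => h; rewrite [h *: 1]mulr1 scalerDl addrA.
split=> -[d1 d2]; (split; first by move: d1; rewrite /derivable /= E);
  by move: d2; rewrite /derive /= E.
Qed.

Lemma is_derive_line0P f x v (b : R) :
  is_derive (0 : R) 1 (fun s : R => f (s *: v + x)) b <-> is_derive x v f b.
Proof. by rewrite is_derive_lineP scale0r add0r. Qed.

(** Both points move, and the error is relative to their mutual distance. Plain differentiability at
    [x] would leave an error relative to the distance to [x], too coarse for increments of order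
    [t^2] between points at distance [t] from [x]. *)
Lemma C1_on_strict U f x : open U -> C1_on U f -> U x ->
  forall e : R, 0 < e -> exists2 d : R, 0 < d &
    forall y z, enorm (y - x) < d -> enorm (z - x) < d ->
      `|f z - f y - dot (gradient f x) (z - y)| <= e * enorm (z - y).
Proof.
move=> oU fU Ux e e0.
have e10 : 0 < e / n.+1%:R by rewrite divr_gt0.
have [d0 d00 hd0] : exists2 d : R, 0 < d & forall y, enorm (y - x) < d ->
    U y /\ forall i, `|partial i f y - partial i f x| <= e / n.+1%:R.
  apply/nbhs_eball; apply: filterI; first exact: open_nbhs_nbhs.
  apply: (@filter_forall _ _
    (fun i y => `|partial i f y - partial i f x| <= e / n.+1%:R) (nbhs x)) => i.
  have [_ /continuous_eballP/(_ _ e10)[d d0 hd]] := fU i x Ux.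
  by apply/nbhs_eball; exists d => // y /hd/ltW.
(* The factor 3: a coordinate of a mean value point is off by at most [d] before the shift, and the
   shift [s] has size at most [2 * d] but unknown sign. *)
pose d := d0 / (3 * n.+1%:R).
have d_gt0 : 0 < d by rewrite divr_gt0 ?mulr_gt0.
exists d => // y z yx zx.
(* The first [k] coordinates come from [z], the others from [y]: consecutive points differ in one
   coordinate, where a partial derivative controls the increment. *)
pose m k : 'rV[R]_n := \row_i (if (i < k)%N then z 0 i else y 0 i).
have m0 : m 0%N = y by apply/rowP => i; rewrite mxE.
have mn : m n = z by apply/rowP => i; rewrite mxE ltn_ord.
have step (k : 'I_n) : m k.+1 = (z 0 k - y 0 k) *: delta_mx 0 k + m k.
  apply/rowP => i; rewrite !mxE eqxx /= ltnS leq_eqVlt.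
  have [->|ik] := eqVneq i k; first by rewrite !eqxx ltnn mulr1 /= subrK.
  by rewrite (inj_eq val_inj) (negPf ik) /= mulr0 add0r.
have yxi i : `|y 0 i - x 0 i| <= d.
  have := normr_coord_le (y - x) i; rewrite !mxE => /le_trans; apply.
  by rewrite (le_trans (normr_le_enorm _)) // ltW.
have zxi i : `|z 0 i - x 0 i| <= d.
  have := normr_coord_le (z - x) i; rewrite !mxE => /le_trans; apply.
  by rewrite (le_trans (normr_le_enorm _)) // ltW.
have inball (k : 'I_n) (s : R) : `|s| <= `|z 0 k - y 0 k| ->
    enorm (s *: delta_mx 0 k + m k - x) < d0.
  move=> sk; apply: le_lt_trans (enorm_le_normr _) _.
  apply: (@le_lt_trans _ _ (n%:R * (3 * d))).
    rewrite ler_wpM2l //; apply: normr_le_coord => [|i]; first by rewrite mulr_ge0 // ltW.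
    rewrite !mxE eqxx /=; have [->|ik] := eqVneq i k.
      rewrite ltnn mulr1; have := yxi k; have := zxi k.
      rewrite !ler_norml => /andP[h1 h2] /andP[h3 h4].
      have : `|z 0 k - y 0 k| <= 2 * d by rewrite ler_norml; apply/andP; split; lra.
      by move=> /(le_trans sk); rewrite ler_norml => /andP[h5 h6]; apply/andP; split; lra.
    rewrite mulr0 add0r; have [_|_] := ifPn.
      by rewrite (le_trans (zxi i)) // ler_peMl ?ltW // ltr1n.
    by rewrite (le_trans (yxi i)) // ler_peMl ?ltW // ltr1n.
  have -> : n%:R * (3 * d) = d0 * (n%:R / n.+1%:R).
    by rewrite /d; field; rewrite ?nat1r ?natr1 pnatr_eq0.
  by rewrite gtr_pMr // ltr_pdivrMr // mul1r ltr_nat.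
have bound (k : 'I_n) :
    `|f (m k.+1) - f (m k) - partial k f x * (z 0 k - y 0 k)| <=
    e / n.+1%:R * `|z 0 k - y 0 k|.
  have [|s s0] := @mvt_sym _ (fun t : R => f (t *: delta_mx 0 k + m k))
    (fun t => partial k f (t *: delta_mx 0 k + m k)) 0 (z 0 k - y 0 k).
    move=> s; rewrite !subr0 => /inball/hd0[Us _].
    by apply/is_derive_lineP; apply/derivableP; have [] := fU k _ Us.
  rewrite scale0r add0r -step subr0 => ->.
  rewrite -mulrBl normrM ler_wpM2r //.
  by move: s0; rewrite !subr0 => /inball/hd0[].
have -> : f z - f y = \sum_(k < n) (f (m k.+1) - f (m k)).
  by rewrite -(big_mkord xpredT (fun k => f (m k.+1) - f (m k))) telescope_sumr // mn m0.
have -> : dot (gradient f x) (z - y) = \sum_(k < n) partial k f x * (z 0 k - y 0 k).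
  by apply: eq_bigr => k _; rewrite !mxE.
rewrite -sumrB; apply: (le_trans (ler_norm_sum _ _ _)).
apply: (@le_trans _ _ (\sum_(k < n) e / n.+1%:R * enorm (z - y))).
  apply: ler_sum => k _; apply: (le_trans (bound k)).
  rewrite ler_wpM2l ?(ltW e10) //; apply: le_trans (normr_le_enorm _).
  by have := normr_coord_le (z - y) k; rewrite !mxE.
rewrite sumr_const card_ord -[leLHS]mulr_natl mulrA ler_wpM2r // mulrCA.
by rewrite ger_pMr // ler_pdivrMr // mul1r ler_nat.
Qed.

Lemma C1_on_is_derive U f x v : open U -> C1_on U f -> U x ->
  is_derive x v f (dot (gradient f x) v).
Proof.
move=> oU fU Ux; apply/is_derive_line0P/is_deriveP => e e0.
have v1 : 0 < enorm v + 1 by rewrite ltr_wpDl.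
have [|d d0 hd] := C1_on_strict oU fU Ux (e := e / (enorm v + 1)).
  by rewrite divr_gt0.
exists (d / (enorm v + 1)); first by rewrite divr_gt0.
move=> t; rewrite !subr0 scale0r add0r ltr_pdivlMr // => td.
have := hd x (t *: v + x); rewrite subrr enorm0 addrK enormZ dotZr => /(_ d0).
have tv : `|t| * enorm v <= `|t| * (enorm v + 1) by rewrite ler_wpM2l // lerDl.
move=> /(_ (le_lt_trans tv td)); rewrite [t * _]mulrC => /le_trans; apply.
by rewrite -mulrA ler_pM2l // mulrC ler_pdivrMr // mulrC.
Qed.

Lemma C1_on_continuous U f x : open U -> C1_on U f -> U x -> {for x, continuous f}.
Proof.
move=> oU fU Ux; apply/continuous_eballP => e e0.
have [d d0 hd] := C1_on_strict oU fU Ux ltr01.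
have k0 : 0 < 1 + enorm (gradient f x) by rewrite ltr_pwDl.
exists (Num.min d (e / (1 + enorm (gradient f x)))); first by rewrite lt_min d0 divr_gt0.
move=> y; rewrite lt_min ltr_pdivlMr // => /andP[yd ye].
have := hd x y; rewrite subrr enorm0 => /(_ d0 yd) h.
apply: le_lt_trans ye; rewrite mulrDr.
rewrite -[f y - f x](subrK (dot (gradient f x) (y - x))).
apply: le_trans (ler_normD _ _) _; rewrite lerD //; first by rewrite mulrC.
by rewrite mulrC normr_dot_le.
Qed.

End Lines.

(** * Quadratic test functions *)

Section Continuity.
Context {R : realType} {n : nat}.
Implicit Types (f g : 'rV[R]_n -> R) (x : 'rV[R]_n).

Lemma rV_continuous_cst (k : R) x : {for x, continuous (fun _ : 'rV[R]_n => k)}.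
Proof. exact: cst_continuous. Qed.

Lemma rV_continuousD f g x : {for x, continuous f} -> {for x, continuous g} ->
  {for x, continuous (fun y => f y + g y)}.
Proof. exact: continuousD. Qed.

Lemma rV_continuousB f g x : {for x, continuous f} -> {for x, continuous g} ->
  {for x, continuous (fun y => f y - g y)}.
Proof. exact: continuousB. Qed.

Lemma rV_continuousM f g x : {for x, continuous f} -> {for x, continuous g} ->
  {for x, continuous (fun y => f y * g y)}.
Proof. exact: continuousM. Qed.

End Continuity.

Section TestFunctions.
Context {R : realType} {n : nat}.
Implicit Types (x y z v : 'rV[R]_n) (al be s : R).

Definition sqdist y x : R := dot (x - y) (x - y).

Lemma sqdistE y x : sqdist y x = enorm (x - y) ^+ 2.
Proof. by rewrite enorm_sqr. Qed.

(** A quadratic polynomial in [|x - y|^2], smooth everywhere including the center, as [C2_on]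
    demands on all of Omega. It stands in for a profile in [|x - y|] near a contact point at squared
    radius [s], where it vanishes. *)
Definition radial_test y al be s x : R :=
  al * (sqdist y x - s) + be / 2 * (sqdist y x - s) ^+ 2.

Lemma is_derive_sqdist y x v : is_derive x v (sqdist y) (2 * dot (x - y) v).
Proof.
apply/is_derive_line0P.
have -> : (fun s : R => sqdist y (s *: v + x)) =
    (fun s : R => sqdist y x + (2 * dot (x - y) v) * s + dot v v * s ^+ 2).
  apply/funext => s; rewrite /sqdist -addrA; move: (x - y) => w.
  rewrite dotDl !dotDr !dotZl !dotZr (dotC w v).
  by ring.
by apply: is_derive_eq; rewrite /GRing.scale /=; ring.
Qed.

Lemma continuous_sqdist y : continuous (sqdist y).
Proof.
move=> x; rewrite (_ : sqdist y = fun x => enorm (x - y) * enorm (x - y)).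
  by apply: (rV_continuousM (f := fun x => enorm (x - y)) (g := fun x => enorm (x - y)));
    exact: continuous_enorm_sub.
by apply/funext => z; rewrite sqdistE expr2.
Qed.

Lemma is_derive_radial_test y al be s x v :
  is_derive x v (radial_test y al be s)
    ((al + be * (sqdist y x - s)) * (2 * dot (x - y) v)).
Proof.
have := is_derive_sqdist y x v => dq.
rewrite /radial_test; apply: is_derive_eq; rewrite /GRing.scale /=; by field.
Qed.

Lemma partial_radial_test y al be s i :
  partial i (radial_test y al be s) =
  (fun x => (al + be * (sqdist y x - s)) * (2 * (x 0 i - y 0 i))).
Proof.
apply/funext => x; rewrite /partial.
have [_ ->] := is_derive_radial_test y al be s x (delta_mx 0 i).
by rewrite dot_delta !mxE.
Qed.

Lemma is_derive_coord x v i : is_derive x v (fun x : 'rV[R]_n => x 0 i) (v 0 i).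
Proof.
apply/is_derive_line0P.
have -> : (fun s : R => (s *: v + x) 0 i) = (fun s : R => s * v 0 i + x 0 i).
  by apply/funext => s; rewrite !mxE.
by apply: is_derive_eq; rewrite /GRing.scale /=; ring.
Qed.

Lemma is_derive_partial_radial_test y al be s i x v :
  is_derive x v (partial i (radial_test y al be s))
    (be * (2 * dot (x - y) v) * (2 * (x 0 i - y 0 i)) +
     (al + be * (sqdist y x - s)) * (2 * v 0 i)).
Proof.
have := is_derive_sqdist y x v => dq; have := is_derive_coord x v i => dx.
rewrite partial_radial_test; apply: is_derive_eq; rewrite /GRing.scale /=; ring.
Qed.

Lemma C2_on_radial_test U y al be s : C2_on U (radial_test y al be s).
Proof.
have cq := @continuous_sqdist y.
have cc i := @coord_continuous R 1 n 0 i.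
split=> [i x _|i j x _]; split.
- by have [] := is_derive_radial_test y al be s x (delta_mx 0 i).
- rewrite partial_radial_test; apply: rV_continuousM; last first.
    apply: rV_continuousM; first exact: rV_continuous_cst.
    by apply: rV_continuousB; [exact: cc|exact: rV_continuous_cst].
  apply: rV_continuousD; first exact: rV_continuous_cst.
  apply: rV_continuousM; first exact: rV_continuous_cst.
  by apply: rV_continuousB; [exact: cq|exact: rV_continuous_cst].
- by have [] := is_derive_partial_radial_test y al be s i x (delta_mx 0 j).
- have -> : partial j (partial i (radial_test y al be s)) =
    (fun x => (be * (2 * (x 0 j - y 0 j)) * (2 * (x 0 i - y 0 i)) +
     (al + be * (sqdist y x - s)) * (2 * (delta_mx 0 j : 'rV[R]_n) 0 i))).
    apply/funext => z; rewrite {1}/partial.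
    have [_ ->] := is_derive_partial_radial_test y al be s i z (delta_mx 0 j).
    by rewrite dot_delta !mxE.
  apply: rV_continuousD; apply: rV_continuousM.
  + apply: rV_continuousM; first exact: rV_continuous_cst.
    apply: rV_continuousM; first exact: rV_continuous_cst.
    by apply: rV_continuousB; [exact: cc|exact: rV_continuous_cst].
  + apply: rV_continuousM; first exact: rV_continuous_cst.
    by apply: rV_continuousB; [exact: cc|exact: rV_continuous_cst].
  + apply: rV_continuousD; first exact: rV_continuous_cst.
    apply: rV_continuousM; first exact: rV_continuous_cst.
    by apply: rV_continuousB; [exact: cq|exact: rV_continuous_cst].
  + exact: rV_continuous_cst.
Qed.

(** With [w = x - y], the gradient at the base radius is [2 al w] and the Hessian is
    [2 al I + 4 be w w^T]. The gradient is an eigenvector, so only the radial eigenvalue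
    [2 al + 4 be s] enters. *)
Lemma infinity_laplacian_radial_test y al be x (s := sqdist y x) :
  infinity_laplacian (radial_test y al be s) x = 8 * al ^+ 3 * s + 16 * al ^+ 2 * be * s ^+ 2.
Proof.
set w := x - y.
have G : gradient (radial_test y al be s) x = (2 * al) *: w.
  by apply/rowP => i; rewrite !mxE partial_radial_test subrr; ring.
rewrite /infinity_laplacian G.
have -> : ((2 * al) *: w) *m (hessian (radial_test y al be s) x)^T =
    (8 * al * be * s + 4 * al ^+ 2) *: w.
  apply/rowP => j; rewrite !mxE.
  transitivity (\sum_k (8 * al * be * w 0 j * (w 0 k * w 0 k) +
                        4 * al ^+ 2 * (w 0 k * (delta_mx 0 j : 'rV[R]_n) 0 k))).
    apply: eq_bigr => k _; rewrite !mxE /partial -/(partial k _).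
    have [_ ->] := is_derive_partial_radial_test y al be s k x (delta_mx 0 j).
    by rewrite dot_delta /s subrr !mxE; ring.
  rewrite big_split /= -!mulr_sumr -/(dot w w) -/(dot w (delta_mx 0 j)) dot_delta.
  by rewrite !mxE /s /sqdist -/w; ring.
by rewrite dotZl dotZr /s /sqdist -/w; ring.
Qed.

Lemma subsolution_test Omega u x y al be : viscosity_subsolution Omega u ->
  Omega x ->
  (\forall z \near x, u z - u x <= radial_test y al be (sqdist y x) z) ->
  - 1 <= 8 * al ^+ 3 * sqdist y x + 16 * al ^+ 2 * be * sqdist y x ^+ 2.
Proof.
move=> su Ox h.
have := su x _ Ox (C2_on_radial_test Omega y al be (sqdist y x)).
rewrite infinity_laplacian_radial_test => H.
suff : - (8 * al ^+ 3 * sqdist y x + 16 * al ^+ 2 * be * sqdist y x ^+ 2) - 1 <= 0.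
  by lra.
apply: H; apply: filterS h => z.
by rewrite [in X in _ <= _ - X]/radial_test subrr; lra.
Qed.

Lemma supersolution_test Omega u x y al be : viscosity_supersolution Omega u ->
  Omega x ->
  (\forall z \near x, radial_test y al be (sqdist y x) z <= u z - u x) ->
  8 * al ^+ 3 * sqdist y x + 16 * al ^+ 2 * be * sqdist y x ^+ 2 <= - 1.
Proof.
move=> su Ox h.
have := su x _ Ox (C2_on_radial_test Omega y al be (sqdist y x)).
rewrite infinity_laplacian_radial_test => H.
suff : 0 <= - (8 * al ^+ 3 * sqdist y x + 16 * al ^+ 2 * be * sqdist y x ^+ 2) - 1.
  by lra.
apply: H; apply: filterS h => z.
by rewrite [in X in _ - X <= _]/radial_test subrr; lra.
Qed.
End TestFunctions.

(** * Radial test functions *)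

Section CubeRoot.
Context {R : realType}.
Implicit Types (q t : R).

(** The cut-off extends the cube root by 0 to a monotone continuous function on the whole line, so
    that barriers make sense at every radius. *)
Definition cbrt q : R := Num.max 0 q `^ 3^-1.

Lemma cbrt_ge0 q : 0 <= cbrt q.
Proof. exact: powR_ge0. Qed.

Lemma cbrtK q : 0 <= q -> cbrt q ^+ 3 = q.
Proof.
move=> q0; rewrite /cbrt max_r // -powR_mulrn ?powR_ge0 // -powRrM mulVf ?pnatr_eq0 //.
by rewrite powRr1.
Qed.

Lemma cbrt_gt0 q : 0 < q -> 0 < cbrt q.
Proof. by move=> q0; rewrite powR_gt0 // max_r // ltW. Qed.

Lemma cbrt0 : cbrt 0 = 0.
Proof. by rewrite /cbrt maxxx powR0 // invr_eq0 pnatr_eq0. Qed.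

Lemma cbrt_le q t : q <= t -> cbrt q <= cbrt t.
Proof.
move=> qt; apply: ge0_ler_powR; rewrite ?invr_ge0 //.
- by rewrite nnegrE le_max lexx.
- by rewrite nnegrE le_max lexx.
by rewrite ge_max !le_max lexx qt orbT.
Qed.

(** The cube of [cbrt] is the positive part, which is 1-Lipschitz. *)
Lemma cbrt_sub q t : q <= t -> cbrt t ^+ 3 <= cbrt q ^+ 3 + (t - q).
Proof.
move=> qt; have [q0|q0] := leP 0 q; first by rewrite !cbrtK ?(le_trans q0 qt) //; lra.
have -> : cbrt q = 0 by rewrite /cbrt max_l ?ltW // powR0 // invr_eq0 pnatr_eq0.
have [t0|t0] := leP 0 t; first by rewrite cbrtK //; lra.
by rewrite /cbrt (max_l (ltW t0)) powR0 ?invr_eq0 ?pnatr_eq0 //; lra.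
Qed.

Lemma cbrt_continuous : continuous cbrt.
Proof.
move=> q; apply/cvgrPdist_lt => e e0; apply/nbhs_ballP.
have e3 : 0 < e ^+ 3 by rewrite exprn_gt0.
exists (e ^+ 3) => // t; rewrite /ball_ /=.
(* The modulus [e^3] comes from [(y - x)^3 <= y^3 - x^3] for [0 <= x <= y]. *)
have main a b : a <= b -> b - a < e ^+ 3 -> cbrt b - cbrt a < e.
  move=> ab /(le_lt_trans _) h; rewrite -(@ltr_pXn2r _ 3) ?nnegrE ?subr_ge0 ?cbrt_le ?(ltW e0) //.
  apply: h; have := cbrt_sub ab; have := cbrt_le ab; have := cbrt_ge0 a.
  set x := cbrt a; set y := cbrt b => x0 xy h.
  have : 0 <= x * y * (y - x) by rewrite !mulr_ge0 ?subr_ge0 // (le_trans x0).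
  nra.
have [qt|tq] := leP q t.
  by rewrite !ler0_norm ?subr_le0 ?cbrt_le // !opprB => /main; apply.
by rewrite !ger0_norm ?subr_ge0 ?cbrt_le ?ltW // => /main; apply; rewrite ltW.
Qed.

Lemma is_derive_cbrt q : 0 < q -> is_derive q 1 cbrt (3 * cbrt q ^+ 2)^-1.
Proof.
move=> q0.
have c0 := cbrt_gt0 q0.
have -> : (3 * cbrt q ^+ 2)^-1 = 3^-1 * q `^ (3^-1 - 1).
  rewrite powRB; last by rewrite (gt_eqF q0) implybT.
  rewrite powRr1 ?(ltW q0) //.
  have -> : q `^ 3^-1 = cbrt q by rewrite /cbrt max_r // ltW.
  by rewrite -[X in _ / X](cbrtK (ltW q0)); field; rewrite gt_eqF.
apply: (@near_eq_is_derive _ _ _ (fun t => t `^ 3^-1)).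
- near=> t; rewrite /cbrt max_r // ltW //; near: t; exact: lt_nbhsr.
- exact: is_derive1_powR.
Unshelve. all: by end_near.
Qed.

End CubeRoot.

(** * Radial profiles as viscosity tests *)

Section RadialTouch.
Context {R : realType}.
Implicit Types (h : R -> R) (r e b : R).

(** Radial tests are polynomials in the squared radius, so the expansion is taken in that variable:
    by the chain rule the first derivative becomes [h1 / (2 r)] and half the second
    [(h'' - h1 / r) / (8 r^2)]. *)
Lemma radial_taylor h h1 r0 b : 0 < r0 ->
  (\forall s \near r0, is_derive (s : R) 1 h (h1 s)) -> is_derive r0 1 h1 b ->
  forall e : R, 0 < e -> exists2 d : R, 0 < d & forall r, 0 <= r -> `|r - r0| < d ->
    `|h r - h r0 - h1 r0 / (2 * r0) * (r ^+ 2 - r0 ^+ 2)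
       - (b - h1 r0 / r0) / (8 * r0 ^+ 2) * (r ^+ 2 - r0 ^+ 2) ^+ 2|
    <= e * (r ^+ 2 - r0 ^+ 2) ^+ 2.
Proof.
move=> r00 dh dh1 e e0.
have [K EK] : {K : R | K = (b - h1 r0 / r0) / 2} by eexists.
pose k := `|K| + 1.
have k0 : 0 < k by rewrite ltr_wpDl.
have e'0 : 0 < e * r0 ^+ 2 / 2 by rewrite divr_gt0 // mulr_gt0 // exprn_gt0.
have [d1 d10 hd1] := taylor2 dh dh1 e'0.
exists (Num.min d1 (Num.min r0 (e * r0 ^+ 3 / (4 * k)))).
  by rewrite !lt_min d10 r00 divr_gt0 ?mulr_gt0 ?exprn_gt0.
move=> r rge0; rewrite !lt_min => /and3P[/hd1 hr Dr0 De].
(* The quadratic expansions in [r] and in [r^2] differ by [K (1 - S^2 / (4 r0^2)) D^2]. The bracket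
   vanishes at [D = 0], and the last bound on the radius makes this cubic term small. *)
pose D := r - r0; pose S := r + r0.
have -> : r ^+ 2 - r0 ^+ 2 = D * S by rewrite /D /S; ring.
set A := (X in `|X| <= _); set E := (X in `|X| <= _) in hr.
have -> : A = E + K * (1 - S ^+ 2 / (4 * r0 ^+ 2)) * D ^+ 2.
  by rewrite /A /E EK /S /D; field; rewrite gt_eqF.
apply: (le_trans (ler_normD _ _)).
have D2 : 0 <= D ^+ 2 by rewrite sqr_ge0.
have Sr0 : r0 ^+ 2 <= S ^+ 2 by rewrite ler_pXn2r ?nnegrE ?addr_ge0 ?(ltW r00) // lerDr.
apply: (@le_trans _ _ (e * r0 ^+ 2 * D ^+ 2)); last first.
  have -> : e * (D * S) ^+ 2 = e * S ^+ 2 * D ^+ 2 by ring.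
  by rewrite ler_wpM2r // ler_wpM2l // ltW.
have -> : e * r0 ^+ 2 * D ^+ 2 = e * r0 ^+ 2 / 2 * D ^+ 2 + e * r0 ^+ 2 / 2 * D ^+ 2.
  by field.
rewrite lerD // normrM (ger0_norm D2) ler_wpM2r // normrM.
have -> : 1 - S ^+ 2 / (4 * r0 ^+ 2) = - (D * (3 * r0 + r) / (4 * r0 ^+ 2)).
  by rewrite /S /D; field; rewrite gt_eqF.
rewrite normrN normrM normrM.
have -> : `|(4 * r0 ^+ 2)^-1| = (4 * r0 ^+ 2)^-1.
  by rewrite ger0_norm // invr_ge0 mulr_ge0 // sqr_ge0.
have h5 : `|3 * r0 + r| <= 8 * r0.
  rewrite ger0_norm ?addr_ge0 ?mulr_ge0 ?(ltW r00) //.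
  by move: Dr0; rewrite ltr_norml => /andP[_]; lra.
have Kk : `|K| <= k by rewrite lerDl.
apply: (@le_trans _ _ (k * (e * r0 ^+ 3 / (4 * k) * (8 * r0) / (4 * r0 ^+ 2)))).
  have I0 : 0 <= (4 * r0 ^+ 2)^-1 by rewrite invr_ge0 mulr_ge0 // sqr_ge0.
  apply: ler_pM; rewrite ?normr_ge0 //; first by rewrite mulr_ge0 // mulr_ge0.
  by rewrite ler_wpM2r //; apply: ler_pM; rewrite ?normr_ge0 // ltW.
suff -> : k * (e * r0 ^+ 3 / (4 * k) * (8 * r0) / (4 * r0 ^+ 2)) = e * r0 ^+ 2 / 2 by [].
by field; rewrite !gt_eqF.
Qed.

End RadialTouch.

Section Touching.
Context {R : realType} {n : nat}.
Implicit Types (Omega : set 'rV[R]_n) (u : 'rV[R]_n -> R) (x y z : 'rV[R]_n).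

(** Squeezing [h] between two smooth tests, [2 * e] apart in the second-order coefficient, lets a
    barrier be tested without extending it to a C^2 function on the whole domain. *)
Lemma radial_test_near h h1 x y (b e : R) (r0 := enorm (x - y)) : 0 < r0 ->
  (\forall s \near r0, is_derive (s : R) 1 h (h1 s)) -> is_derive r0 1 h1 b ->
  0 < e ->
  let be := (b - h1 r0 / r0) / (4 * r0 ^+ 2) in
  \forall z \near x,
    radial_test y (h1 r0 / (2 * r0)) (be - e) (r0 ^+ 2) z
      <= h (enorm (z - y)) - h r0
      <= radial_test y (h1 r0 / (2 * r0)) (be + e) (r0 ^+ 2) z.
Proof.
move=> r00 dh dh1 e0 be.
have e20 : 0 < e / 2 by rewrite divr_gt0.
have [d d0 hd] := radial_taylor r00 dh dh1 e20.
apply/nbhs_eball; exists d => // z zx.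
have := hd _ (enorm_ge0 (z - y)).
have zd : `|enorm (z - y) - r0| < d.
  apply: le_lt_trans zx; rewrite ler_norml lerNl opprB /r0.
  have := enorm_sub (x - y) (z - y); have := enorm_sub (z - y) (x - y).
  by rewrite !opprB !subrKA (enormB x z) => -> ->.
move=> /(_ zd); rewrite /radial_test sqdistE.
set X := enorm (z - y) ^+ 2 - _.
have -> : (b - h1 r0 / r0) / (8 * r0 ^+ 2) = be / 2.
  by rewrite /be; field; rewrite gt_eqF.
by rewrite ler_norml => /andP[l1 l2]; apply/andP; split; lra.
Qed.

(** [h1 r0 ^+ 2 * b] is the infinity Laplacian of the radial function; the tangential curvature
    [h1 r0 / r0] cancels. A slack [e / k] in the second-order coefficient changes the result by
    [e / k * (k - 1)], which is below [e]. *)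
Lemma subsolution_radial_test Omega u h h1 x y (b : R) (r0 := enorm (x - y)) :
  viscosity_subsolution Omega u -> Omega x -> 0 < r0 ->
  (\forall s \near r0, is_derive (s : R) 1 h (h1 s)) -> is_derive r0 1 h1 b ->
  (\forall z \near x, u z - u x <= h (enorm (z - y)) - h r0) ->
  - 1 <= h1 r0 ^+ 2 * b.
Proof.
move=> su Ox r00 dh dh1 touch.
apply/ler_addgt0Pl => e e0.
pose k := 4 * h1 r0 ^+ 2 * r0 ^+ 2 + 1.
have k0 : 0 < k by rewrite ltr_wpDl // mulr_ge0 ?sqr_ge0 // mulr_ge0 ?sqr_ge0.
have ek : 0 < e / k by rewrite divr_gt0.
have near_test := radial_test_near r00 dh dh1 ek.
have := @subsolution_test _ _ Omega u x y (h1 r0 / (2 * r0))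
  ((b - h1 r0 / r0) / (4 * r0 ^+ 2) + e / k) su Ox.
rewrite sqdistE -/r0.
have -> : 8 * (h1 r0 / (2 * r0)) ^+ 3 * r0 ^+ 2 +
    16 * (h1 r0 / (2 * r0)) ^+ 2 * ((b - h1 r0 / r0) / (4 * r0 ^+ 2) + e / k) *
    r0 ^+ 2 ^+ 2 = e / k * (k - 1) + h1 r0 ^+ 2 * b.
  by rewrite /k; field; rewrite -/k !gt_eqF.
rewrite mulrBr divfK ?gt_eqF // mulr1 => H.
suff : - 1 <= e - e / k + h1 r0 ^+ 2 * b by move: ek; lra.
apply: H; apply: filterS2 touch near_test => z h2 /andP[_ h3].
exact: le_trans h3.
Qed.

Lemma supersolution_radial_test Omega u h h1 x y (b : R) (r0 := enorm (x - y)) :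
  viscosity_supersolution Omega u -> Omega x -> 0 < r0 ->
  (\forall s \near r0, is_derive (s : R) 1 h (h1 s)) -> is_derive r0 1 h1 b ->
  (\forall z \near x, h (enorm (z - y)) - h r0 <= u z - u x) ->
  h1 r0 ^+ 2 * b <= - 1.
Proof.
move=> su Ox r00 dh dh1 touch.
apply/ler_addgt0Pr => e e0.
pose k := 4 * h1 r0 ^+ 2 * r0 ^+ 2 + 1.
have k0 : 0 < k by rewrite ltr_wpDl // mulr_ge0 ?sqr_ge0 // mulr_ge0 ?sqr_ge0.
have ek : 0 < e / k by rewrite divr_gt0.
have near_test := radial_test_near r00 dh dh1 ek.
have := @supersolution_test _ _ Omega u x y (h1 r0 / (2 * r0))
  ((b - h1 r0 / r0) / (4 * r0 ^+ 2) - e / k) su Ox.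
rewrite sqdistE -/r0.
have -> : 8 * (h1 r0 / (2 * r0)) ^+ 3 * r0 ^+ 2 +
    16 * (h1 r0 / (2 * r0)) ^+ 2 * ((b - h1 r0 / r0) / (4 * r0 ^+ 2) - e / k) *
    r0 ^+ 2 ^+ 2 = - (e / k * (k - 1)) + h1 r0 ^+ 2 * b.
  by rewrite /k; field; rewrite -/k !gt_eqF.
rewrite mulrBr divfK ?gt_eqF // mulr1 => H.
suff : - (e - e / k) + h1 r0 ^+ 2 * b <= - 1 by move: ek; lra.
apply: H; apply: filterS2 touch near_test => z h2 /andP[h3 _].
exact: le_trans h2.
Qed.

End Touching.

(** * Radial barriers *)

Section Barriers.
Context {R : realType}.
Implicit Types (m r s eta : R).

(** For [s < r] the product h'^2 h'' is the constant [- 64 m^3 / (81 r^4)], whence the threshold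
    81/64. The profile is 0 at [s = 0], reaches its height [m] at [s = r], and stays there because
    of the cut-off in [cbrt]. *)
Definition upper_barrier m r s : R := m * (1 - cbrt (1 - s / r) ^+ 4).

Lemma is_derive_cbrt_affine r s : 0 < r -> s < r ->
  is_derive s 1 (fun t => cbrt (1 - t / r)) ((3 * cbrt (1 - s / r) ^+ 2)^-1 * - r^-1).
Proof.
move=> r0 sr.
have dg : is_derive s 1 (fun t : R => 1 - t / r) (- r^-1).
  by apply: is_derive_eq; rewrite /GRing.scale /=; ring.
have dc : is_derive (1 - s / r) 1 cbrt ((3 * cbrt (1 - s / r) ^+ 2)^-1).
  by apply: is_derive_cbrt; rewrite subr_gt0 ltr_pdivrMr // mul1r.
exact: (@is_derive1_comp _ cbrt (fun t : R => 1 - t / r)).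
Qed.

Lemma is_derive_upper_barrier m r s : 0 < r -> s < r ->
  is_derive s 1 (upper_barrier m r) (4 * m / (3 * r) * cbrt (1 - s / r)).
Proof.
move=> r0 sr; have dc := is_derive_cbrt_affine r0 sr.
have c0 : 0 < cbrt (1 - s / r) by rewrite cbrt_gt0 // subr_gt0 ltr_pdivrMr // mul1r.
rewrite /upper_barrier; apply: is_derive_eq; rewrite /GRing.scale /=.
by field; rewrite !gt_eqF.
Qed.

Lemma is_derive2_upper_barrier m r s : 0 < r -> s < r ->
  is_derive s 1 (fun t => 4 * m / (3 * r) * cbrt (1 - t / r))
    (- (4 * m / (9 * r ^+ 2)) / cbrt (1 - s / r) ^+ 2).
Proof.
move=> r0 sr; have dc := is_derive_cbrt_affine r0 sr.
have c0 : 0 < cbrt (1 - s / r) by rewrite cbrt_gt0 // subr_gt0 ltr_pdivrMr // mul1r.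
apply: is_derive_eq; rewrite /GRing.scale /=.
by field; rewrite !gt_eqF.
Qed.

Lemma upper_barrier_ge0 m r s : 0 <= m -> 0 < r -> 0 <= s <= r -> 0 <= upper_barrier m r s.
Proof.
move=> m0 r0 /andP[s0 sr]; rewrite mulr_ge0 // subr_ge0.
rewrite exprn_ile1 ?cbrt_ge0 //.
rewrite -(@ler_pXn2r _ 3) ?nnegrE ?cbrt_ge0 // cbrtK ?expr1n.
  by rewrite gerBl divr_ge0 // ltW.
by rewrite subr_ge0 ler_pdivrMr // mul1r.
Qed.

Lemma upper_barrier_lt m r s : 0 < m -> 0 < r -> s < r -> upper_barrier m r s < m.
Proof.
move=> m0 r0 sr; rewrite /upper_barrier gtr_pMr // gtrBl exprn_gt0 // cbrt_gt0 //.
by rewrite subr_gt0 ltr_pdivrMr // mul1r.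
Qed.

(** The right-hand side is the tangent at [s = 0] of a concave profile. *)
Lemma upper_barrier_le m r s : 0 <= m -> 0 < r -> 0 <= s <= r ->
  upper_barrier m r s <= 4 * m / (3 * r) * s.
Proof.
move=> m0 r0 /andP[s0 sr].
have -> : 4 * m / (3 * r) * s = m * (4 / 3 * (s / r)) by field; rewrite gt_eqF.
rewrite /upper_barrier ler_wpM2l //.
have E : s / r = 1 - cbrt (1 - s / r) ^+ 3.
  by rewrite cbrtK ?subKr // subr_ge0 ler_pdivrMr // mul1r.
rewrite [X in 4 / 3 * X]E.
have := cbrt_ge0 (1 - s / r); move: (cbrt _) => c c0.
(* With [c^3 = 1 - s / r] the tangent inequality reads [1 - 4 c^3 + 3 c^4 >= 0], a polynomial with
   the double root 1. *)
have : 0 <= (1 - c) ^+ 2 * (1 + 2 * c + 3 * c ^+ 2).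
  by rewrite mulr_ge0 ?sqr_ge0 // !addr_ge0 // mulr_ge0 // sqr_ge0.
by nra.
Qed.

Lemma continuous_upper_barrier m r : continuous (upper_barrier m r).
Proof.
move=> s; apply: cvgM; first exact: cvg_cst.
apply: cvgB; first exact: cvg_cst.
have ca : {for s, continuous (fun t : R => 1 - t / r)}.
  apply: cvgB; first exact: cvg_cst.
  by apply: cvgM; [exact: cvg_id|exact: cvg_cst].
have cc := continuous_comp ca (@cbrt_continuous R _).
exact: (continuous_comp cc (@exprn_continuous _ 4 _)).
Qed.

(* The derivative satisfies [- lower_barrier1 ^ 3 = 3 r^3 / (r + eta)^2], which is
   smooth at 0 and increases at a rate below 3: a strict subsolution without
   singularity at the center, unlike the exact solution with [r^(4/3)]. *)
Definition lower_barrier eta r : R :=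
  - cbrt 3 * (3 / 4 * cbrt (r + eta) ^+ 4 - 3 * eta * cbrt (r + eta)).

Definition lower_barrier1 eta r : R := - cbrt 3 * r / cbrt (r + eta) ^+ 2.

Lemma is_derive_cbrt_shift eta r : 0 < r + eta ->
  is_derive r 1 (fun t => cbrt (t + eta)) ((3 * cbrt (r + eta) ^+ 2)^-1).
Proof.
move=> r0.
have dg : is_derive r 1 (fun t : R => t + eta) 1.
  by apply: is_derive_eq; rewrite addr0.
have dc := is_derive_cbrt r0; rewrite -[X in is_derive _ _ _ X]mulr1.
exact: (@is_derive1_comp _ cbrt (fun t : R => t + eta)).
Qed.

Lemma is_derive_lower_barrier eta r : 0 < r + eta ->
  is_derive r 1 (lower_barrier eta) (lower_barrier1 eta r).
Proof.
move=> r0; have dc := is_derive_cbrt_shift r0; have c0 := cbrt_gt0 r0.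
rewrite /lower_barrier /lower_barrier1; apply: is_derive_eq; rewrite /GRing.scale /=.
rewrite -[r in - cbrt 3 * r](addrK eta) -[X in _ * (X - eta) / _](cbrtK (ltW r0)).
by field; rewrite !gt_eqF.
Qed.

Lemma is_derive2_lower_barrier eta r : 0 < r + eta ->
  is_derive r 1 (lower_barrier1 eta)
    (- cbrt 3 * (r + 3 * eta) / (3 * cbrt (r + eta) ^+ 5)).
Proof.
move=> r0; have dc := is_derive_cbrt_shift r0; have c0 := cbrt_gt0 r0.
have c20 : cbrt (r + eta) ^+ 2 != 0 by rewrite gt_eqF // exprn_gt0.
have dv : is_derive r 1 (fun t => (cbrt (t + eta) ^+ 2)^-1)
    (- 2 / (3 * cbrt (r + eta) ^+ 5)).
  have dq : is_derive r 1 (fun t => cbrt (t + eta) ^+ 2)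
      (2 * cbrt (r + eta) * (3 * cbrt (r + eta) ^+ 2)^-1).
    by apply: is_derive_eq; rewrite /GRing.scale /=; ring.
  apply: is_derive_eq (is_deriveV (f := fun t => cbrt (t + eta) ^+ 2) c20 dq) _.
  by rewrite /GRing.scale /=; field; rewrite gt_eqF.
rewrite /lower_barrier1; apply: is_derive_eq; rewrite /GRing.scale /=.
have E : r = cbrt (r + eta) ^+ 3 - eta by rewrite cbrtK ?(ltW r0) // addrK.
rewrite [in - cbrt 3 * r]E [X in X + 3 * eta]E.
by field; rewrite gt_eqF.
Qed.
End Barriers.

(** * Comparison with the barriers *)

Lemma ltr_dist_subl {R : realType} (a b c d e : R) :
  `|a - b| < e / 2 -> `|c - d| < e / 2 -> `|a - c - (b - d)| < e.
Proof. by rewrite !ltr_norml => /andP[h1 h2] /andP[h3 h4]; apply/andP; split; lra. Qed.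

Lemma lerB_swapl {R : realType} (a b c d : R) : a - b <= c - d -> a - c <= b - d.
Proof. lra. Qed.

Lemma lerB_swapr {R : realType} (a b c d : R) : a - b <= c - d -> d - b <= c - a.
Proof. lra. Qed.

(** * Closure, boundary and continuity through Euclidean balls *)

Section Topology.
Context {R : realType} {n : nat}.
Implicit Types (A : set 'rV[R]_n) (x y z : 'rV[R]_n).

Lemma closureE_bdry A x : open A -> closure A x <-> A x \/ bdry A x.
Proof.
move=> oA; have -> : bdry A x = (closure A x /\ ~ A x) by rewrite /bdry ((interior_id A).1 oA).
split=> [cx|[Ax|[]//]]; last exact: subset_closure.
by have [Ax|nAx] := pselect (A x); [left|right].
Qed.

Lemma bdry_notin A x : open A -> bdry A x -> ~ A x.
Proof. by move=> oA [_]; rewrite ((interior_id A).1 oA). Qed.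

Lemma bdry_closure A x : bdry A x -> closure A x.
Proof. by case. Qed.

Lemma compact_closure A : bounded_set A -> compact (closure A).
Proof.
move=> /bounded_enormP[M hM]; apply: bounded_closed_compact; last exact: closed_closure.
apply/bounded_enormP; exists (M + 1) => x /closure_eballP/(_ _ ltr01)[y Ay yx].
rewrite -[x](subrK y) (le_trans (enormD _ _)) // addrC lerD ?hM //.
by rewrite enormB ltW.
Qed.

Lemma closed_cball y (r : R) : closed [set x | enorm (x - y) <= r].
Proof.
have -> : [set x | enorm (x - y) <= r] = (fun x => enorm (x - y)) @^-1` [set t | t <= r].
  by [].
by apply: preimage_closed => [x _|]; [exact: continuous_enorm_sub|exact: closed_le].
Qed.

Lemma within_continuousP A (f : 'rV[R]_n -> R) :
  {within A, continuous f} <->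
  forall x, A x -> forall e : R, 0 < e -> exists2 d : R, 0 < d &
    forall y, A y -> enorm (y - x) < d -> `|f y - f x| < e.
Proof.
rewrite subspace_continuousP; split => H x Ax.
  move=> e e0; have := H x Ax.
  move=> /(@cvgrPdist_lt _ R^o _ (within A (nbhs x)) _ f (f x))/(_ e e0).
  rewrite near_withinE => /nbhs_eball[d d0 hd]; exists d => // y Ay yx.
  by rewrite distrC; exact: hd.
apply/(@cvgrPdist_lt _ R^o _ (within A (nbhs x)) _ f (f x)) => e e0.
have [d d0 hd] := H x Ax e e0; rewrite near_withinE.
by apply/nbhs_eball; exists d => // y yx Ay; rewrite distrC; exact: hd.
Qed.

Lemma within_continuous_enormP A (f : 'rV[R]_n -> 'rV[R]_n) :
  {within A, continuous f} ->
  forall x, A x -> forall e : R, 0 < e -> exists2 d : R, 0 < d &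
    forall y, A y -> enorm (y - x) < d -> enorm (f y - f x) < e.
Proof.
rewrite subspace_continuousP => H x Ax e e0.
have P : nbhs (f x) (eball (f x) e) by apply/nbhs_eball; exists e.
have := H x Ax _ P; rewrite nbhs_filterE /= => /nbhs_eball[d d0 hd].
by exists d => // y Ay yx; exact: hd.
Qed.

End Topology.

Section Dirichlet.
Context {R : realType} {n : nat} (Omega : set 'rV[R]_n) (u : 'rV[R]_n -> R).
Context (Omega_open : open Omega) (Omega_bounded : bounded_set Omega)
  (u_solution : dirichlet_solution Omega u).
Implicit Types (x y z c w : 'rV[R]_n) (r m eta : R).

Let u_cont : {within closure Omega, continuous u}. Proof. by case: u_solution. Qed.
Let u_bdry x : bdry Omega x -> u x = 0. Proof. by case: u_solution => _ + _ _; apply. Qed.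
Let u_sub : viscosity_subsolution Omega u. Proof. by case: u_solution. Qed.
Let u_super : viscosity_supersolution Omega u. Proof. by case: u_solution. Qed.

Lemma near_Omega x : Omega x -> \forall z \near x, Omega z.
Proof. by move=> Ox; apply: open_nbhs_nbhs. Qed.

(** A minimum inside [Omega] would be touched from below by a constant, whose infinity Laplacian 0
    is not at most -1. So the minimum is on the boundary. *)
Lemma dirichlet_ge0 x : closure Omega x -> 0 <= u x.
Proof.
move=> cx.
have [|x0 + umin] := EVT_min_rV _ (compact_closure Omega_bounded) u_cont.
  by exists x.
rewrite inE => cx0; apply: le_trans (umin x _); last by rewrite inE.
have [Ox0|/u_bdry ->//] := (closureE_bdry x0 Omega_open).1 cx0.
rewrite leNgt; apply/negP => _.
have := @supersolution_test _ _ Omega u x0 x0 0 0 u_super Ox0.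
suff H : \forall z \near x0, radial_test x0 0 0 (sqdist x0 x0) z <= u z - u x0.
  by move=> /(_ H); lra.
apply: filterS (near_Omega Ox0) => z Oz.
rewrite /radial_test !mul0r addr0 subr_ge0 umin // inE.
exact: subset_closure.
Qed.

(** A point where [u] minus the barrier is maximal and positive is not on the boundary, where [u] is
    0, nor at distance [r], where the barrier is [m], nor at the center, which is outside [Omega].
    Elsewhere the subsolution test contradicts the strict bound on [m]. *)
Lemma le_upper_barrier y r m : bdry Omega y -> 0 < r -> 0 < m ->
  81 / 64 * r ^+ 4 < m ^+ 3 ->
  (forall x, closure Omega x -> enorm (x - y) <= r -> u x <= m) ->
  forall x, closure Omega x -> enorm (x - y) <= r ->
    u x <= upper_barrier m r (enorm (x - y)).
Proof.
move=> dy r0 m0 rm um x cx xy.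
pose K := closure Omega `&` [set x | enorm (x - y) <= r].
have cK : compact K by apply: compact_closedI; [exact: compact_closure|exact: closed_cball].
pose w x := u x - upper_barrier m r (enorm (x - y)).
have cb : continuous (fun x => upper_barrier m r (enorm (x - y))).
  move=> z; apply: (continuous_comp (@continuous_enorm_sub _ _ y z)).
  exact: continuous_upper_barrier.
have wK : {within K, continuous w}.
  apply/within_continuousP => z [cz zy] e e0.
  have e20 : 0 < e / 2 by rewrite divr_gt0.
  have [d1 d10 hd1] := (within_continuousP _ _).1 u_cont z cz _ e20.
  have [d2 d20 hd2] := (continuous_eballP _ _).1 (cb z) _ e20.
  exists (Num.min d1 d2) => [|t [ct ty]]; rewrite ?lt_min ?d10 // => /andP[td1 td2].
  by apply: ltr_dist_subl; [exact: hd1|exact: hd2].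
have [|x0 + wmax] := EVT_max_rV _ cK wK; first by exists x.
rewrite inE => -[cx0 x0y]; rewrite -subr_le0; apply: le_trans (wmax x _) _.
  by rewrite inE.
rewrite /w subr_le0 leNgt; apply/negP => hlt.
have xy0 := enorm_ge0 (x0 - y).
have Ox0 : Omega x0.
  have [//|/u_bdry ux0] := (closureE_bdry x0 Omega_open).1 cx0.
  by move: hlt; rewrite ux0 ltNge upper_barrier_ge0 ?(ltW m0) ?xy0.
have x0r : enorm (x0 - y) < r.
  rewrite lt_neqAle x0y andbT; apply/eqP => e; move: hlt.
  by rewrite e /upper_barrier divff ?gt_eqF // subrr cbrt0 expr0n subr0 mulr1 ltNge um.
have x0y0 : 0 < enorm (x0 - y).
  rewrite enorm_gt0 subr_eq0; apply/eqP => e.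
  by apply: (bdry_notin Omega_open dy); rewrite -e.
have := @subsolution_radial_test _ _ Omega u _ _ x0 y _ u_sub Ox0 x0y0 _
  (is_derive2_upper_barrier m r0 x0r).
have H1 : \forall s \near enorm (x0 - y),
    is_derive (s : R) 1 (upper_barrier m r) (4 * m / (3 * r) * cbrt (1 - s / r)).
  near=> s; apply: is_derive_upper_barrier => //; near: s; exact: lt_nbhsl.
move=> /(_ _ H1).
have H2 : \forall z \near x0, u z - u x0 <=
    upper_barrier m r (enorm (z - y)) - upper_barrier m r (enorm (x0 - y)).
  have nr : \forall z \near x0, enorm (z - y) < r.
    apply/nbhs_eball; exists (r - enorm (x0 - y)); first by rewrite subr_gt0.
    move=> z zx; rewrite (le_lt_trans (enorm_triangle x0 _ _)) //.
    by rewrite -ltrBrDr.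
  apply: filterS2 (near_Omega Ox0) nr => z Oz zr.
  have := wmax z; rewrite inE => /(_ (conj (subset_closure Oz) (ltW zr))).
  exact: lerB_swapl.
move=> /(_ H2).
have c0 : 0 < cbrt (1 - enorm (x0 - y) / r).
  by rewrite cbrt_gt0 // subr_gt0 ltr_pdivrMr // mul1r.
have -> : (4 * m / (3 * r) * cbrt (1 - enorm (x0 - y) / r)) ^+ 2 *
   (- (4 * m / (9 * r ^+ 2)) / cbrt (1 - enorm (x0 - y) / r) ^+ 2) =
   - (64 * m ^+ 3 / (81 * r ^+ 4)).
  by field; rewrite !gt_eqF.
rewrite lerN2 ler_pdivrMr ?mulr_gt0 ?exprn_gt0 // mul1r.
by move: rm; lra.
Unshelve. all: by end_near.
Qed.

(** Subtracting [lower_barrier eta r] makes the barrier vanish on the sphere, where [u] is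
    nonnegative; strictness excludes a negative minimum of the difference inside. *)
Lemma ge_lower_barrier c r eta : 0 < r -> 0 < eta -> eball c r `<=` Omega ->
  forall x, enorm (x - c) <= r ->
    lower_barrier eta (enorm (x - c)) - lower_barrier eta r <= u x.
Proof.
move=> r0 eta0 cr x xc.
pose K := [set x | enorm (x - c) <= r].
(* Pulling a point of the sphere slightly towards the center brings it into the open ball. *)
have KO z : K z -> closure Omega z.
  move=> zr; apply/closure_eballP => e e0.
  have [->|z0] := eqVneq z c.
    by exists c; rewrite ?subrr ?enorm0 //; apply: cr; rewrite /eball /= subrr enorm0.
  have zp : 0 < enorm (z - c) by rewrite enorm_gt0 subr_eq0.
  pose t := Num.min (1 / 2) (e / (2 * enorm (z - c))).
  have t0 : 0 < t by rewrite lt_min !divr_gt0 // mulr_gt0.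
  have t1 : t < 1 by rewrite gt_min; apply/orP; left; lra.
  exists (z - t *: (z - c)).
    apply: cr; rewrite /eball /=.
    have -> : z - t *: (z - c) - c = (1 - t) *: (z - c).
      by rewrite scalerBl scale1r addrAC.
    rewrite enormZ ger0_norm ?subr_ge0 ?ltW //.
    apply: lt_le_trans zr; rewrite gtr_pMl // ltrBlDr ltrDl //.
  rewrite addrAC subrr sub0r enormN enormZ gtr0_norm //.
  have : t * enorm (z - c) <= e / 2.
    rewrite -ler_pdivlMr // -mulrA -invfM ge_min; apply/orP; right; by [].
  by lra.
have cK : compact K.
  apply: (subclosed_compact _ (compact_closure Omega_bounded)) => //.
  exact: closed_cball.
pose w x := u x - lower_barrier eta (enorm (x - c)).
have cb : continuous (fun x => lower_barrier eta (enorm (x - c))).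
  move=> z; apply: (continuous_comp (@continuous_enorm_sub _ _ c z)).
  by apply: is_derive_continuous (is_derive_lower_barrier _); rewrite ltr_wpDl.
have wK : {within K, continuous w}.
  apply/within_continuousP => z zK e e0.
  have e20 : 0 < e / 2 by rewrite divr_gt0.
  have [d1 d10 hd1] := (within_continuousP _ _).1 u_cont z (KO _ zK) _ e20.
  have [d2 d20 hd2] := (continuous_eballP _ _).1 (cb z) _ e20.
  exists (Num.min d1 d2) => [|t tK]; rewrite ?lt_min ?d10 // => /andP[td1 td2].
  by apply: ltr_dist_subl; [exact: hd1 (KO _ tK) td1|exact: hd2].
have [|x0 + wmin] := EVT_min_rV _ cK wK; first by exists x.
rewrite inE => x0K.
suff : - lower_barrier eta r <= w x0.
  move=> /le_trans/(_ (wmin x _)); rewrite inE => /(_ xc).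
  by rewrite /w lerBrDr addrC.
rewrite leNgt; apply/negP => hlt.
have x0r : enorm (x0 - c) < r.
  rewrite lt_neqAle x0K andbT; apply/eqP => e; move: hlt.
  rewrite /w e ltNge lerBrDr addrC subrr; apply/negP/negPn.
  by apply: dirichlet_ge0; exact: KO.
have Ox0 : Omega x0 by apply: cr.
have nr : \forall z \near x0, enorm (z - c) < r.
  apply/nbhs_eball; exists (r - enorm (x0 - c)); first by rewrite subr_gt0.
  move=> z zx; rewrite (le_lt_trans (enorm_triangle x0 _ _)) //.
  by rewrite -ltrBrDr.
have touch : \forall z \near x0,
    lower_barrier eta (enorm (z - c)) - lower_barrier eta (enorm (x0 - c)) <= u z - u x0.
  apply: filterS nr => z zr.
  have := wmin z; rewrite inE => /(_ (ltW zr)).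
  exact: lerB_swapr.
have near_der (s : R) : 0 <= s ->
    \forall t \near s, is_derive (t : R) 1 (lower_barrier eta) (lower_barrier1 eta t).
  move=> s0; near=> t; apply: is_derive_lower_barrier; near: t.
  have : - eta < s by rewrite (lt_le_trans _ s0) // oppr_lt0.
  by move=> /lt_nbhsr; apply: filterS => t; rewrite -subr_gt0 opprK.
(* At the center every radial test has zero gradient, so any quadratic below the barrier gives a
   contradiction; [b / 2 - 1] is the second-order coefficient of the barrier less the tolerance 1
   taken in [taylor2]. *)
have [x0c|x0c] := eqVneq x0 c.
  have d2 : is_derive (0 : R) 1 (lower_barrier1 eta)
      (- cbrt 3 * (0 + 3 * eta) / (3 * cbrt (0 + eta) ^+ 5)).
    by apply: is_derive2_lower_barrier; rewrite add0r.
  have [d d0 hd] := taylor2 (near_der 0 (lexx 0)) d2 ltr01.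
  set b := - cbrt 3 * _ / _ in d2 hd.
  have := @supersolution_test _ _ Omega u x0 c (b / 2 - 1) 0 u_super Ox0.
  have H : \forall z \near x0, radial_test c (b / 2 - 1) 0 (sqdist c x0) z <= u z - u x0.
    have nd : \forall z \near x0, enorm (z - c) < d.
      by apply/nbhs_eball; exists d => // z; rewrite x0c.
    apply: filterS2 touch nd => z h1 zd; apply: le_trans h1.
    rewrite /radial_test !sqdistE x0c subrr enorm0 expr0n subr0 mul0r mul0r addr0.
    have := hd (enorm (z - c)); rewrite subr0 ger0_norm // => /(_ zd).
    by rewrite /lower_barrier1 mulr0 !mul0r subr0 ler_norml => /andP[h2 _]; lra.
  move=> /(_ H); rewrite sqdistE x0c subrr enorm0 expr0n /= expr0n /=.
  by rewrite !mulr0 addr0; lra.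
have x0c0 : 0 < enorm (x0 - c) by rewrite enorm_gt0 subr_eq0.
have re : 0 < enorm (x0 - c) + eta by rewrite addr_gt0.
have := @supersolution_radial_test _ _ Omega u _ _ x0 c _ u_super Ox0 x0c0
  (near_der _ (ltW x0c0)) (is_derive2_lower_barrier re) touch.
set s := enorm (x0 - c) in re x0c0 *.
have cp := cbrt_gt0 re.
have -> : lower_barrier1 eta s ^+ 2 *
    (- cbrt 3 * (s + 3 * eta) / (3 * cbrt (s + eta) ^+ 5)) =
    - (s ^+ 2 * (s + 3 * eta) / (s + eta) ^+ 3).
  rewrite /lower_barrier1.
  transitivity (- ((cbrt 3 ^+ 3) * s ^+ 2 * (s + 3 * eta) / (3 * (cbrt (s + eta) ^+ 3) ^+ 3))).
    by field; rewrite !gt_eqF.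
  by rewrite !cbrtK ?(ltW re) //; field; rewrite !gt_eqF.
rewrite lerN2 ler_pdivlMr ?exprn_gt0 // mul1r.
(* This is [(s + eta)^3 - s^2 (s + 3 eta)], the margin by which the barrier is strict. *)
have : 0 < s * eta ^+ 2 * 3 + eta ^+ 3 by rewrite addr_gt0 ?mulr_gt0 ?exprn_gt0.
by lra.
Unshelve. all: by end_near.
Qed.

End Dirichlet.

(** * Distance to the boundary and slope at the boundary *)

Section Distance.
Context {R : realType} {n : nat}.
Implicit Types (A Omega : set 'rV[R]_n) (x y z w : 'rV[R]_n).

Lemma dist_to_le x A y : A y -> dist_to x A <= enorm (x - y).
Proof.
move=> Ay; apply: ge_inf; last by exists y.
by exists 0 => _ [z _ <-].
Qed.

Lemma dist_to_ge x A (k : R) : A !=set0 ->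
  (forall y, A y -> k <= enorm (x - y)) -> k <= dist_to x A.
Proof.
move=> [y Ay] kA; apply: lb_le_inf; first by exists (enorm (x - y)); exists y.
by move=> _ [z Az <-]; exact: kA.
Qed.

Lemma dist_to_attained x A : compact A -> A !=set0 ->
  exists2 y, A y & dist_to x A = enorm (x - y).
Proof.
move=> cA A0.
have cf : {within A, continuous (fun y => enorm (y - x))}.
  by apply: continuous_subspaceT; exact: continuous_enorm_sub.
have [y + ymin] := EVT_min_rV A0 cA cf.
rewrite inE => Ay; exists y => //; apply/eqP; rewrite eq_le dist_to_le //=.
apply: dist_to_ge => // z Az; rewrite !(enormB x).
by apply: ymin; rewrite inE.
Qed.

Lemma dist_to_lip A x z : A !=set0 -> dist_to x A <= enorm (x - z) + dist_to z A.
Proof.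
move=> A0; rewrite -lerBlDl; apply: dist_to_ge => // y Ay; rewrite lerBlDl.
by rewrite (le_trans (dist_to_le _ Ay)) // enorm_triangle.
Qed.

Lemma continuous_dist_to A : A !=set0 -> continuous (fun x => dist_to x A).
Proof.
move=> A0; apply: (@continuous_lipschitz _ _ _ 1) => x y.
by rewrite mul1r lerBlDr dist_to_lip.
Qed.

Lemma closed_bdry A : closed (bdry A).
Proof.
rewrite /bdry setDE; apply: closedI; first exact: closed_closure.
exact/open_closedC/open_interior.
Qed.

Lemma compact_bdry A : bounded_set A -> compact (bdry A).
Proof.
move=> bA; apply: (subclosed_compact (@closed_bdry A) (compact_closure bA)).
exact: bdry_closure.
Qed.

(** The point at the supremum of the parameters that stay in [A] is a limit of points of [A]; if it
    were in [A], openness would allow a larger parameter. *)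
Lemma segment_meets_bdry A x z : open A -> A x -> ~ A z ->
  exists2 t : R, 0 < t <= 1 & bdry A (x + t *: (z - x)).
Proof.
move=> oA Ax nAz.
pose T := [set t : R | 0 <= t <= 1 /\ A (x + t *: (z - x))].
have T0 : T 0 by rewrite /T /= lexx ler01 scale0r addr0.
have Tub : ubound T 1 by move=> t [/andP[]].
have supT : has_sup T by split; [exists 0|exists 1].
pose s := sup T.
have s0 : 0 <= s by apply: ub_le_sup => //; case: supT.
have s1 : s <= 1 by apply: ge_sup => //; exists 0.
have step t k : enorm (x + t *: (z - x) - (x + k *: (z - x))) = `|t - k| * enorm (z - x).
  by rewrite opprD addrACA subrr add0r -scalerBl enormZ.
have clA : closure A (x + s *: (z - x)).
  apply/closure_eballP => e e0.
  have k0 : 0 < enorm (z - x) + 1 by rewrite ltr_wpDl.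
  have [|t [t01 At] st] := @sup_adherent _ T (e / (enorm (z - x) + 1)) _ supT.
    by rewrite divr_gt0.
  exists (x + t *: (z - x)) => //; rewrite step.
  have ts : t <= s by apply: ub_le_sup; [case: supT|].
  rewrite ler0_norm ?subr_le0 // opprB.
  have : (s - t) * (enorm (z - x) + 1) < e.
    by rewrite -ltr_pdivlMr //; move: st; rewrite -/s; lra.
  apply: le_lt_trans; rewrite ler_wpM2l ?subr_ge0 // lerDl //.
have nA : ~ A (x + s *: (z - x)).
  move=> As; have [s1e|s1l] := eqVneq s 1.
    by apply: nAz; move: As; rewrite s1e scale1r subrKC.
  have /open_eballP/(_ _ As)[e e0 eA] := oA.
  have k0 : 0 < enorm (z - x) + 1 by rewrite ltr_wpDl.
  pose t := Num.min 1 (s + e / (enorm (z - x) + 1)).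
  have st : s < t.
    by rewrite lt_min lt_neqAle s1l s1 /= ltrDl divr_gt0.
  have : T t.
    split; first by rewrite (le_trans s0 (ltW st)) /= ge_min lexx.
    apply: eA; rewrite /eball /= step gtr0_norm ?subr_gt0 //.
    have : (t - s) * (enorm (z - x) + 1) <= e.
      by rewrite -ler_pdivlMr // lerBlDl ge_min lexx orbT.
    apply: lt_le_trans; rewrite ltr_pM2l ?subr_gt0 // ltrDl //.
  by move/(ub_le_sup _) => /(_ (proj2 supT)); rewrite -/s leNgt st.
exists s; last by split=> //; rewrite ((interior_id A).1 oA).
rewrite s1 andbT lt_neqAle s0 andbT eq_sym; apply/eqP => e0.
by apply: nA; rewrite e0 scale0r addr0.
Qed.

Section Domain.
Context (Omega : set 'rV[R]_n) (Omega_open : open Omega)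
  (Omega_bounded : bounded_set Omega) (bdry_neq0 : bdry Omega !=set0).

Lemma bdry_dist_attained x :
  exists2 y, bdry Omega y & bdry_dist Omega x = enorm (x - y).
Proof. by apply: dist_to_attained => //; exact: compact_bdry. Qed.

Lemma bdry_dist_ge0 x : 0 <= bdry_dist Omega x.
Proof. by have [y _ ->] := bdry_dist_attained x. Qed.

Lemma bdry_dist_gt0 x : Omega x -> 0 < bdry_dist Omega x.
Proof.
move=> Ox; have [y dy ->] := bdry_dist_attained x.
rewrite enorm_gt0 subr_eq0; apply/eqP => e.
by apply: (bdry_notin Omega_open dy); rewrite -e.
Qed.

Lemma bdry_dist_bdry x : bdry Omega x -> bdry_dist Omega x = 0.
Proof.
move=> dx; apply/eqP; rewrite eq_le bdry_dist_ge0 andbT.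
by rewrite (le_trans (dist_to_le _ dx)) // subrr enorm0.
Qed.

Lemma eball_bdry_dist x : Omega x -> eball x (bdry_dist Omega x) `<=` Omega.
Proof.
move=> Ox z; rewrite /eball /= => zx; have [//|nOz] := pselect (Omega z).
have [t /andP[t0 t1] /(dist_to_le x)] := segment_meets_bdry Omega_open Ox nOz.
rewrite opprD addNKr enormN enormZ gtr0_norm // => h.
have := lt_le_trans zx h; rewrite ltNge ler_piMl //.
Qed.

Lemma le_bdry_dist x (r : R) : eball x r `<=` Omega -> r <= bdry_dist Omega x.
Proof.
move=> rO; have [y dy ->] := bdry_dist_attained x.
rewrite leNgt; apply/negP => h; apply: (bdry_notin Omega_open dy).
by apply: rO; rewrite /eball /= enormB.
Qed.

Lemma le_inradius x : closure Omega x -> bdry_dist Omega x <= inradius Omega.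
Proof.
move=> cx; apply: ub_le_sup; last by exists x.
have [y dy] := bdry_neq0.
have cd : {within closure Omega, continuous (bdry_dist Omega)}.
  by apply: continuous_subspaceT; exact: continuous_dist_to.
have [|z _ zmax] := EVT_max_rV _ (compact_closure Omega_bounded) cd.
  by exists x.
by exists (bdry_dist Omega z) => _ [t ct <-]; apply: zmax; rewrite inE.
Qed.

End Domain.
End Distance.

Section PowerPerturbation.
Context {R : realType}.
Implicit Types (k A r : R).

(** A strict inequality leaves room to change the radius or the height a little; this is how strict
    barriers reach the sharp constants. *)
Lemma exprn_lt_left N k A r : 0 < r -> A < k * r ^+ N ->
  exists2 s, 0 < s < r & A < k * s ^+ N.
Proof.
move=> r0 Ar.
have c : {for r, continuous (fun s : R => k * s ^+ N)}.
  apply: cvgM; [exact: cvg_cst|exact: exprn_continuous].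
have /nbhs_ballP[e /= e0 he] : \forall s \near (r : R), A < k * s ^+ N.
  exact: (c _ (lt_nbhsr Ar)).
exists (Num.max (r / 2) (r - e / 2)).
  by rewrite lt_max divr_gt0 //= gt_max; apply/andP; split; lra.
apply: he; rewrite /ball /= gtr0_norm.
  by rewrite ltrBlDr -ltrBlDl lt_max; apply/orP; right; lra.
by rewrite subr_gt0 gt_max; apply/andP; split; lra.
Qed.

Lemma exprn_lt_right N k A r : k * r ^+ N < A ->
  exists2 s, r < s & k * s ^+ N < A.
Proof.
move=> Ar.
have c : {for r, continuous (fun s : R => k * s ^+ N)}.
  apply: cvgM; [exact: cvg_cst|exact: exprn_continuous].
have /nbhs_ballP[e /= e0 he] : \forall s \near (r : R), k * s ^+ N < A.
  exact: (c _ (lt_nbhsl Ar)).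
exists (r + e / 2); first by rewrite ltrDl divr_gt0.
by apply: he; rewrite /ball /= opprD addNKr normrN gtr0_norm ?divr_gt0 //; lra.
Qed.

End PowerPerturbation.

(** * Slopes of the solution at boundary points *)

Section BoundarySlope.
Context {R : realType} {n : nat} (Omega : set 'rV[R]_n) (u : 'rV[R]_n -> R)
  (delta : R) (G : 'rV[R]_n -> 'rV[R]_n).
Context (Omega_open : open Omega) (Omega_bounded : bounded_set Omega)
  (bdry_neq0 : bdry Omega !=set0)
  (u_solution : dirichlet_solution Omega u)
  (delta_gt0 : 0 < delta) (u_C1 : C1_up_to_bdry Omega delta u G).
Implicit Types (x y z c w : 'rV[R]_n) (r m t e : R).

Let V := Omega `&` [set x | bdry_dist Omega x < delta].

Let V_open : open V.
Proof.
apply: openI => //.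
apply: (@open_comp _ _ (bdry_dist Omega) [set t | t < delta]).
  by move=> x _; exact: continuous_dist_to.
exact: open_lt.
Qed.

Let V_layer x : V x -> bdry_layer Omega delta x.
Proof. by move=> [Ox dx]; split=> //; exact: subset_closure. Qed.

Let gradientV x : V x -> gradient u x = G x.
Proof. by move=> Vx; have [_ /(_ _ (V_layer Vx) Vx.1)[]] := u_C1. Qed.

Let C1_V : C1_on V u.
Proof.
move=> i x Vx; have [cG /(_ _ (V_layer Vx) Vx.1)[dux _]] := u_C1.
split; first exact: dux.
apply/continuous_eballP => e e0.
have [d1 d10 hd1] := within_continuous_enormP cG (V_layer Vx) e0.
have [d2 d20 hd2] := (open_eballP V).1 V_open x Vx.
exists (Num.min d1 d2) => [|y]; rewrite ?lt_min ?d10 // => /andP[yd1 yd2].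
have Vy : V y by apply: hd2.
have pE z : V z -> partial i u z = G z 0 i by move=> Vz; rewrite -gradientV // mxE.
rewrite !pE //; apply: le_lt_trans (hd1 y (V_layer Vy) yd1).
apply: le_trans (normr_le_enorm _).
by have := normr_coord_le (G y - G x) i; rewrite !mxE.
Qed.

(** [G y] is only a limit of interior gradients. The mean value theorem on the segment from [y],
    with continuity of [u] up to that endpoint, turns it into a one-sided expansion of [u]. *)
Lemma boundary_slope y w t0 e : bdry Omega y -> 0 < t0 ->
  (forall t, 0 < t <= t0 -> Omega (y + t *: w)) -> 0 < e ->
  exists2 t1, 0 < t1 & forall t, 0 < t <= t1 ->
    `|u (y + t *: w) - t * dot (G y) w| <= e * t.
Proof.
move=> dy t00 inO e0.
have layer_y : bdry_layer Omega delta y.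
  by split; [exact: bdry_closure|rewrite bdry_dist_bdry].
have k0 : 0 < enorm w + 1 by rewrite ltr_wpDl.
have ek0 : 0 < e / (enorm w + 1) by rewrite divr_gt0.
have [cG _] := u_C1.
have [d d0 hd] := within_continuous_enormP cG layer_y ek0.
(* The segment stays within [d] of [y], for the continuity of [G], and within [delta] of the
   boundary; the summand 1 covers [w = 0]. *)
exists (Num.min t0 (Num.min d delta / (enorm w + 1))).
  by rewrite lt_min t00 divr_gt0 // lt_min d0.
move=> t /andP[tp]; rewrite le_min => /andP[tt0 td].
have inV s : 0 < s <= t -> V (y + s *: w) /\ enorm (y + s *: w - y) < d.
  move=> /andP[s0 st].
  have : enorm (y + s *: w - y) < Num.min d delta.
    rewrite addrAC subrr add0r enormZ gtr0_norm //.
    have : s * (enorm w + 1) <= Num.min d delta.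
      by rewrite -ler_pdivlMr // (le_trans st).
    by apply: lt_le_trans; rewrite ltr_pM2l // ltrDl.
  rewrite lt_min => /andP[h1 h2]; split=> //; split.
    by apply: inO; rewrite s0 (le_trans st).
  exact: le_lt_trans (dist_to_le _ dy) h2.
have [||s] := @MVT R (fun s => u (s *: w + y)) (fun s => dot (G (s *: w + y)) w) 0 t tp.
- move=> s; rewrite in_itv /= => /andP[s0 st].
  have [Vs _] : V (y + s *: w) /\ enorm (y + s *: w - y) < d.
    by apply: inV; rewrite s0 ltW.
  apply/is_derive_lineP; rewrite addrC -gradientV //.
  exact: C1_on_is_derive V_open C1_V Vs.
- apply/subspace_continuousP => s; rewrite /= in_itv /= => /andP[s0 st].
  apply/(@cvgrPdist_lt _ R^o _ (within _ (nbhs s)) _ (fun s => u (s *: w + y))) => e' e'0.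
  have clO s' : 0 <= s' <= t -> closure Omega (s' *: w + y).
    move=> /andP[s'0 s't]; have [->|s'n0] := eqVneq s' 0.
      by rewrite scale0r add0r; exact: bdry_closure.
    apply: subset_closure; rewrite addrC; apply: inO.
    by rewrite lt_neqAle eq_sym s'n0 s'0 /= (le_trans s't).
  have [uc _ _ _] := u_solution.
  have [|d' d'0 hd'] := (within_continuousP _ _).1 uc (s *: w + y) _ _ e'0.
    by apply: clO; rewrite s0.
  rewrite near_withinE; apply/nbhs_ballP; exists (d' / (enorm w + 1)).
    by rewrite /= divr_gt0.
  move=> s'; rewrite /ball /= in_itv /= ltr_pdivlMr // => ss' s'I.
  rewrite distrC; apply: hd'; first exact: clO.
  rewrite opprD addrACA subrr addr0 -scalerBl enormZ distrC.
  by apply: le_lt_trans ss'; rewrite ler_wpM2l // lerDl.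
rewrite in_itv /= => /andP[s0 st]; rewrite scale0r add0r subr0.
have -> : u y = 0 by case: u_solution => _ + _ _; apply.
rewrite subr0 addrC => ->.
have [Vs sd] : V (y + s *: w) /\ enorm (y + s *: w - y) < d.
  by apply: inV; rewrite s0 ltW.
rewrite [t * _]mulrC -mulrBl -dotBl normrM (gtr0_norm tp) ler_wpM2r ?(ltW tp) //.
apply: le_trans (normr_dot_le _ _) _.
rewrite [y + _]addrC in Vs sd; have h := ltW (hd _ (V_layer Vs) sd).
apply: (@le_trans _ _ (e / (enorm w + 1) * (enorm w + 1))); last first.
  by rewrite divfK // gt_eqF.
by apply: ler_pM; rewrite ?enorm_ge0 // lerDl.
Qed.

(** The lower bound may fail by [e * t], as happens when it comes from differentiating a barrier.
    The companion upper bound is exactly linear because it comes from a tangent line. *)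
Lemma boundary_slope_ge y w t0 k : bdry Omega y -> 0 < t0 ->
  (forall t, 0 < t <= t0 -> Omega (y + t *: w)) ->
  (forall e, 0 < e -> exists2 t1, 0 < t1 &
    forall t, 0 < t <= t1 -> t * (k - e) <= u (y + t *: w)) ->
  k <= dot (G y) w.
Proof.
move=> dy t00 inO uk; apply/ler_addgt0Pl => e e0.
have e20 : 0 < e / 2 by rewrite divr_gt0.
have [t1 t10 h1] := boundary_slope dy t00 inO e20.
have [t2 t20 h2] := uk _ e20.
pose t := Num.min t1 t2.
have tp : 0 < t by rewrite lt_min t10.
have := h1 t; rewrite tp ge_min lexx /= => /(_ isT).
have := h2 t; rewrite tp ge_min lexx orbT /= => /(_ isT).
rewrite ler_norml => l1 /andP[l2 l3].
by rewrite -(ler_pM2l tp); lra.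
Qed.

Lemma boundary_slope_le y w t0 k : bdry Omega y -> 0 < t0 ->
  (forall t, 0 < t <= t0 -> Omega (y + t *: w)) ->
  (exists2 t1, 0 < t1 & forall t, 0 < t <= t1 -> u (y + t *: w) <= t * k) ->
  dot (G y) w <= k.
Proof.
move=> dy t00 inO [t2 t20 h2]; apply/ler_addgt0Pl => e e0.
have [t1 t10 h1] := boundary_slope dy t00 inO e0.
pose t := Num.min t1 t2.
have tp : 0 < t by rewrite lt_min t10.
have := h1 t; rewrite tp ge_min lexx /= => /(_ isT).
have := h2 t; rewrite tp ge_min lexx orbT /= => /(_ isT).
rewrite ler_norml => l1 /andP[l2 l3].
by rewrite -(ler_pM2l tp); lra.
Qed.

End BoundarySlope.

(** * Boundary points are reached from the high ridge *)

Section Overdetermined.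
Context {R : realType} {n : nat} (Omega : set 'rV[R]_n) (u : 'rV[R]_n -> R)
  (delta a : R) (G : 'rV[R]_n -> 'rV[R]_n).
Context (Omega_open : open Omega) (Omega_bounded : bounded_set Omega)
  (bdry_neq0 : bdry Omega !=set0)
  (Omega_sphere : interior_sphere_condition Omega)
  (u_solution : dirichlet_solution Omega u)
  (delta_gt0 : 0 < delta) (u_C1 : C1_up_to_bdry Omega delta u G)
  (u_overdetermined : forall x, bdry Omega x -> enorm (G x) = a).
Implicit Types (x y z c w : 'rV[R]_n) (r m t e : R).

Let slope_ge := boundary_slope_ge Omega_open Omega_bounded bdry_neq0 u_solution delta_gt0 u_C1.
Let slope_le := boundary_slope_le Omega_open Omega_bounded bdry_neq0 u_solution delta_gt0 u_C1.

(** [|y + t w - c|^2 = r^2 - 2 t dot w (c - y) + t^2 |w|^2] is below [r^2] for small positive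
    [t]. *)
Lemma ball_direction c r y w : eball c r `<=` Omega -> enorm (y - c) = r ->
  0 < dot w (c - y) ->
  exists2 t0, 0 < t0 & forall t, 0 < t <= t0 -> Omega (y + t *: w).
Proof.
move=> cr yc wc.
have k0 : 0 < enorm w ^+ 2 + 1 by rewrite ltr_wpDl // sqr_ge0.
exists (dot w (c - y) / (enorm w ^+ 2 + 1)); first by rewrite divr_gt0.
move=> t /andP[t0 ht]; apply: cr; rewrite /eball /= addrAC addrC.
have r0 : 0 <= r by rewrite -yc.
rewrite -(@ltr_pXn2r _ 2) ?nnegrE // enormD_sqr yc dotZl enormZ gtr0_norm // exprMn.
have -> : dot w (y - c) = - dot w (c - y) by rewrite -dotNr opprB.
move: ht; rewrite ler_pdivlMr // => ht.
have h2 : t * (t * (enorm w ^+ 2 + 1)) <= t * dot w (c - y) by rewrite ler_wpM2l // ltW.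
move: wc h2; have := sqr_ge0 (enorm w); move: (dot _ _) (enorm w ^+ 2) => d k k1 d0 h2.
have := mulr_gt0 t0 d0; have := mulr_ge0 (sqr_ge0 t) k1.
have := exprn_gt0 2 t0; lra.
Qed.

(** Since [u] is nonnegative and vanishes at [y], its slope is nonnegative in every direction
    entering the ball and, in the limit, in every tangent direction. So [G y] is a nonnegative
    multiple of the inner normal, which sees the full length [a]. *)
Lemma boundary_gradient_normal y c r : bdry Omega y -> 0 < r ->
  eball c r `<=` Omega -> enorm (y - c) = r -> a * r <= dot (G y) (c - y).
Proof.
move=> dy r0 cr yc; set nu := c - y.
have nur : enorm nu = r by rewrite /nu enormB.
have nu2 : dot nu nu = r ^+ 2 by rewrite -enorm_sqr nur.
have cone w : 0 < dot w nu -> 0 <= dot (G y) w.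
  move=> wnu; have [t0 t00 h] := ball_direction cr yc wnu.
  apply: (slope_ge dy t00 h) => e e0; exists t0 => // t /andP[tp tt0].
  apply: (@le_trans _ _ 0); first by rewrite sub0r mulrN oppr_le0 mulr_ge0 ?ltW.
  apply: (dirichlet_ge0 Omega_open Omega_bounded u_solution).
  by apply: subset_closure; apply: h; rewrite tp.
have gnu : 0 <= dot (G y) nu by apply: cone; rewrite nu2 exprn_gt0.
have cone0 w : dot w nu = 0 -> 0 <= dot (G y) w.
  move=> wnu; apply/ler_addgt0Pl => e e0.
  have k0 : 0 < dot (G y) nu + 1 by rewrite ltr_wpDl.
  have ek : 0 < e / (dot (G y) nu + 1) by rewrite divr_gt0.
  have : 0 < dot (w + (e / (dot (G y) nu + 1)) *: nu) nu.
    by rewrite dotDl wnu add0r dotZl nu2 mulr_gt0 // exprn_gt0.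
  move=> /cone; rewrite dotDr dotZr => /le_trans; apply.
  rewrite addrC lerD2r mulrAC ler_pdivrMr // ler_pM2l // lerDl //.
(* Minus the tangential part of [G y]: a nonnegative slope along it forces that part to vanish. *)
have := cone0 ((dot (G y) nu / r ^+ 2) *: nu - G y).
rewrite dotBl dotZl nu2 divfK ?gt_eqF ?exprn_gt0 // (dotC (G y)) subrr => /(_ erefl).
rewrite dotBr dotZr -enorm_sqr u_overdetermined // (dotC nu) subr_ge0.
rewrite mulrAC ler_pdivlMr ?exprn_gt0 // -exprMn -expr2.
have a0 : 0 <= a by rewrite -(u_overdetermined dy).
by rewrite ler_pXn2r // nnegrE // mulr_ge0 // ltW.
Qed.

(** The shifted lower barrier vanishes at [p] and lies below [u] along the radius, so its slope
    [- lower_barrier1 eta r] is at most [a]. As [eta] tends to 0 this slope tends to the cube root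
    of [3 r]. *)
Lemma touching_slope p c r : bdry Omega p -> 0 < r -> eball c r `<=` Omega ->
  enorm (p - c) = r -> 3 * r <= a ^+ 3.
Proof.
move=> dp r0 cr pc; pose w := c - p.
have wr : enorm w = r by rewrite /w enormB.
have a0 : 0 <= a by rewrite -(u_overdetermined dp).
have inO t : 0 < t <= 1 -> Omega (p + t *: w).
  move=> /andP[t0 t1]; apply: cr; rewrite /eball /=.
  have -> : p + t *: w - c = (t - 1) *: w.
    by rewrite scalerBl scale1r /w opprB addrAC addrC.
  rewrite enormZ wr ler0_norm ?subr_le0 // opprB gtr_pMl // ltrBlDr ltrDl //.
have key eta : 0 < eta -> - lower_barrier1 eta r <= a.
  move=> eta0.
  have re : 0 < r + eta by rewrite addr_gt0.
  suff : - lower_barrier1 eta r * r <= dot (G p) w.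
    move=> /le_trans/(_ (dot_le _ _)); rewrite wr u_overdetermined //.
    by rewrite ler_pM2r.
  apply: (slope_ge dp ltr01 inO) => e e0.
  have er0 : 0 < e / r by rewrite divr_gt0.
  have [d d0 hd] := (is_deriveP _ _ _).1 (is_derive_lower_barrier re) _ er0.
  exists (Num.min 1 (d / (2 * r))); first by rewrite lt_min ltr01 divr_gt0 // mulr_gt0.
  move=> t /andP[t0]; rewrite le_min => /andP[t1]; rewrite ler_pdivlMr ?mulr_gt0 // => td.
  have ptc : enorm (p + t *: w - c) = (1 - t) * r.
    have -> : p + t *: w - c = (t - 1) *: w.
      by rewrite scalerBl scale1r /w opprB addrAC addrC.
    by rewrite enormZ wr ler0_norm ?subr_le0 // opprB.
  have := @ge_lower_barrier _ _ Omega u Omega_open Omega_bounded u_solution c r eta r0 eta0 cr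
    (p + t *: w).
  rewrite ptc ler_piMl ?(ltW r0) // ?gerBl ?(ltW t0) // => /(_ isT).
  have := hd ((1 - t) * r).
  have -> : (1 - t) * r - r = - (t * r) by ring.
  have tr0 : 0 < t * r by rewrite mulr_gt0.
  rewrite normrN gtr0_norm // => H.
  have : t * r < d by rewrite (lt_le_trans _ td) // mulrCA ltr_pMl // ltr1n.
  have E : e / r * (t * r) = e * t by field; rewrite gt_eqF.
  move=> /H; rewrite E ler_norml mulrN opprK => /andP[h _].
  apply: le_trans; move: h.
  move: (lower_barrier _ _) (lower_barrier _ _) (lower_barrier1 _ _) => A B C h.
  by lra.
rewrite leNgt; apply/negP => ar.
have a30 : 0 <= a ^+ 3 by rewrite exprn_ge0.
(* An explicit [eta] replaces the limit: [3 r^3 / (r + eta)^2 >= 3 r - 6 eta], so a deficit of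
   [18 eta] is already contradictory. *)
pose eta := (3 * r - a ^+ 3) / 18.
have eta0 : 0 < eta by rewrite divr_gt0 // subr_gt0.
have etar : eta <= r by rewrite /eta; lra.
have re : 0 < r + eta by rewrite addr_gt0.
have := key eta eta0.
have c0 := cbrt_gt0 re.
have c30 : 0 < cbrt (3 : R) by rewrite cbrt_gt0.
rewrite -(@ler_pXn2r _ 3) ?nnegrE //; last first.
  by rewrite /lower_barrier1 !mulNr opprK divr_ge0 ?mulr_ge0 ?sqr_ge0 // ltW.
have -> : (- lower_barrier1 eta r) ^+ 3 = 3 * r ^+ 3 / (r + eta) ^+ 2.
  transitivity (cbrt 3 ^+ 3 * r ^+ 3 / (cbrt (r + eta) ^+ 3) ^+ 2).
    by rewrite /lower_barrier1; field; rewrite !gt_eqF.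
  by rewrite !cbrtK // ltW.
rewrite ler_pdivrMr ?exprn_gt0 // leNgt => /negP; apply.
rewrite sqrrD.
have E : a ^+ 3 = 3 * r - 18 * eta by rewrite /eta; field.
rewrite E -subr_gt0.
have -> : 3 * r ^+ 3 - (3 * r - 18 * eta) * (r ^+ 2 + r * eta *+ 2 + eta ^+ 2) =
  r * eta * (12 * r + 33 * eta) + 18 * eta ^+ 3 by ring.
have h1 : 0 < 12 * r + 33 * eta by lra.
have h2 : 0 < 18 * eta ^+ 3 by rewrite mulr_gt0 // exprn_gt0.
by rewrite addr_gt0 // mulr_gt0 // mulr_gt0.
Qed.

(** The barrier bounds [u] along the inner normal; since [G y] is normal, this bounds [a] itself and
    not merely one component. *)
Lemma bounded_slope y r m : bdry Omega y -> 0 < r -> 0 < m ->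
  81 / 64 * r ^+ 4 < m ^+ 3 ->
  (forall x, closure Omega x -> enorm (x - y) <= r -> u x <= m) ->
  a <= 4 * m / (3 * r).
Proof.
move=> dy r0 m0 rm um.
have [c [r1 [r10 cr1 /bdry_eball yc]]] := Omega_sphere dy.
pose w := c - y.
have wr : enorm w = r1 by rewrite /w enormB.
have wnu : 0 < dot w (c - y) by rewrite -enorm_sqr wr exprn_gt0.
have [t0 t00 inO] := ball_direction cr1 yc wnu.
rewrite -(ler_pM2r r10); apply: (le_trans (boundary_gradient_normal dy r10 cr1 yc)).
apply: (slope_le dy t00 inO); exists (Num.min t0 (r / r1)).
  by rewrite lt_min t00 divr_gt0.
move=> t /andP[tp]; rewrite le_min => /andP[tt0]; rewrite ler_pdivlMr // => tr.
have yt : enorm (y + t *: (c - y) - y) = t * r1.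
  by rewrite addrAC subrr add0r enormZ gtr0_norm // wr.
have cl : closure Omega (y + t *: (c - y)).
  by apply: subset_closure; apply: inO; rewrite tp.
have := le_upper_barrier Omega_open Omega_bounded u_solution dy r0 m0 rm um cl.
rewrite yt => /(_ tr) /le_trans; apply.
rewrite [leRHS]mulrCA; apply: upper_barrier_le; rewrite ?(ltW m0) //.
by rewrite tr mulr_ge0 // ltW.
Qed.

Lemma bounded_slope_cube y r m : bdry Omega y -> 0 < r ->
  m ^+ 3 < 81 / 64 * r ^+ 4 ->
  (forall x, closure Omega x -> enorm (x - y) <= r -> u x <= m) -> a ^+ 3 <= 3 * r.
Proof.
move=> dy r0 rm um; rewrite leNgt; apply/negP => ra.
have a0 : 0 < a.
  rewrite lt_neqAle -(u_overdetermined dy) enorm_ge0 andbT eq_sym.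
  apply/eqP => a0; move: ra; rewrite -(u_overdetermined dy) a0 expr0n /=.
  by rewrite ltNge mulr_ge0 // ltW.
(* The height whose slope bound [4 m1 / (3 r)] equals [a]. The assumption [3 r < a^3] makes its
   barrier strict, so a slightly smaller height is still admissible and gives a slope below [a]. *)
pose m1 := 3 * r * a / 4.
have m10 : 0 < m1 by rewrite divr_gt0 // !mulr_gt0.
have : 81 / 64 * r ^+ 4 < 1 * m1 ^+ 3.
  have -> : 1 * m1 ^+ 3 = 27 / 64 * r ^+ 3 * a ^+ 3 by rewrite /m1; field.
  have -> : 81 / 64 * r ^+ 4 = 27 / 64 * r ^+ 3 * (3 * r) by field.
  by rewrite ltr_pM2l // mulr_gt0 // exprn_gt0.
move=> /(exprn_lt_left m10)[m2 /andP[m20 m21]]; rewrite mul1r => rm2.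
have mm2 : m <= m2.
  rewrite leNgt; apply/negP => h; move: (lt_trans rm rm2).
  by rewrite ltNge => /negP; apply; rewrite ler_pXn2r ?nnegrE ?(ltW h) ?(ltW m20) //
    (ltW (lt_trans m20 h)).
have := @bounded_slope y r m2 dy r0 m20 rm2 _.
move=> /(_ (fun x cx xy => le_trans (um x cx xy) mm2)).
rewrite ler_pdivlMr ?mulr_gt0 // leNgt => /negP; apply.
by move: m21; rewrite /m1; lra.
Qed.

(** Around a nearest boundary point, with radius slightly above the distance, the barrier of height
    [u x] is still below [u x] at [x]. It cannot dominate [u] there, so its threshold must fail. *)
Lemma max_le_dist x : Omega x -> 0 < u x -> (forall z, closure Omega z -> u z <= u x) ->
  u x ^+ 3 <= 81 / 64 * bdry_dist Omega x ^+ 4.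
Proof.
move=> Ox ux umax; rewrite leNgt; apply/negP.
move=> /exprn_lt_right[r dr rm].
have [y dy dxy] := bdry_dist_attained Omega_bounded bdry_neq0 x.
have r0 : 0 < r by rewrite (le_lt_trans _ dr) // bdry_dist_ge0.
have := @le_upper_barrier _ _ Omega u Omega_open Omega_bounded u_solution y r (u x) dy r0 ux rm
  (fun z cz _ => umax z cz) x (subset_closure Ox).
rewrite -dxy (ltW dr) => /(_ isT); rewrite leNgt => /negP; apply.
exact: upper_barrier_lt.
Qed.

(** Let [z] maximize [u] on the ball around [y], and [x] globally. Then [81/64 rho^4 <= u z ^+ 3],
    as otherwise a radius below [rho] would give [a^3 < 3 rho]; and [u x ^+ 3] is at most 81/64
    times the fourth power of the distance, hence at most [81/64 rho^4]. Equality makes [z] a global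
    maximum at distance [rho]. *)
Theorem bdry_reaches_ridge (rho := inradius Omega) p c : 0 < rho ->
  bdry Omega p -> eball c rho `<=` Omega -> enorm (p - c) = rho ->
  forall y, bdry Omega y -> exists2 z, high_ridge Omega z & enorm (z - y) <= rho.
Proof.
move=> rho0 dp crho pc y dy.
have arho := touching_slope dp rho0 crho pc.
have [uc ub _ _] := u_solution.
pose K := closure Omega `&` [set x | enorm (x - y) <= rho].
have cK : compact K by apply: compact_closedI; [exact: compact_closure|exact: closed_cball].
have uK : {within K, continuous u}.
  by apply: continuous_subspaceW uc => z [].
have [|z + zmax] := EVT_max_rV _ cK uK.
  by exists y; split; [exact: bdry_closure|rewrite /= subrr enorm0 ltW].
rewrite inE => -[cz zy].
have zrho : 81 / 64 * rho ^+ 4 <= u z ^+ 3.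
  rewrite leNgt; apply/negP => /(exprn_lt_left rho0)[r /andP[r0 rrho] zr].
  have : a ^+ 3 <= 3 * r.
    apply: (bounded_slope_cube dy r0 zr) => x cx xy; apply: zmax; rewrite inE.
    by split=> //; rewrite /= (le_trans xy) // ltW.
  by move: arho; rewrite leNgt => /[swap] h /negP; apply; rewrite (le_lt_trans h) // ltr_pM2l.
have uz0 : 0 < u z.
  rewrite ltNge; apply/negP => uz0; move: zrho.
  have -> : u z = 0.
    by apply/eqP; rewrite eq_le uz0 (dirichlet_ge0 Omega_open Omega_bounded u_solution).
  by rewrite expr0n /= leNgt mulr_gt0 // exprn_gt0.
have Oz x : closure Omega x -> 0 < u x -> Omega x.
  move=> cx ux; have [//|/ub e] := (closureE_bdry x Omega_open).1 cx.
  by rewrite e ltxx in ux.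
have [|x + xmax] := EVT_max_rV _ (compact_closure Omega_bounded) uc; first by exists z.
rewrite inE => cx.
have xmax' v : closure Omega v -> u v <= u x by move=> cv; apply: xmax; rewrite inE.
have ux0 := lt_le_trans uz0 (xmax' z cz).
have hx := max_le_dist (Oz x cx ux0) ux0 xmax'.
have h1 : u x ^+ 3 <= 81 / 64 * rho ^+ 4.
  apply: (le_trans hx); rewrite ler_pM2l // ler_pXn2r ?nnegrE ?bdry_dist_ge0 ?(ltW rho0) //.
  exact: le_inradius.
have uxz : u x = u z.
  apply/eqP; rewrite eq_le xmax' // andbT -(@ler_pXn2r _ 3) ?nnegrE ?(ltW uz0) ?(ltW ux0) //.
  exact: le_trans zrho.
have Ozz := Oz z cz uz0.
exists z => //; split=> //; apply/eqP; rewrite eq_le le_inradius //=.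
have := max_le_dist Ozz uz0; rewrite -uxz => /(_ xmax').
rewrite uxz => /(le_trans zrho); rewrite ler_pM2l //.
by rewrite ler_pXn2r ?nnegrE ?bdry_dist_ge0 // ltW.
Qed.

End Overdetermined.

(** * Convex domains and their high ridge *)

Lemma differentiable_linear_approx {R : realFieldType} (V W : normedModType R)
    (f : V -> W) (L : {linear V -> W}) x : continuous L ->
  (forall e : R, 0 < e -> \forall h \near (0 : V), `|f (h + x) - f x - L h| <= e * `|h|) ->
  differentiable f x.
Proof.
move=> cL H.
have E : f \o shift x = cst (f x) + L +o_ 0 id.
  apply/eqaddoP => e /H; apply: filterS => h.
  by rewrite opprD addrA.
by apply/diff_locallyP; rewrite (diff_unique cL E).
Qed.

Section Differentiability.
Context {R : realType} {n : nat}.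
Implicit Types (f : 'rV[R]_n -> R) (x y v : 'rV[R]_n).

Lemma differentiable_enorm f x v :
  (forall e : R, 0 < e -> exists2 d : R, 0 < d & forall y, enorm (y - x) < d ->
    `|f y - f x - dot (y - x) v| <= e * enorm (y - x)) ->
  differentiable f x.
Proof.
move=> H.
have lin : linear (fun h : 'rV[R]_n => dot h v : R).
  by move=> k a b; rewrite dotDl dotZl.
pose LM := GRing.isLinear.Build _ _ _ _ _ lin.
pose L : {linear 'rV[R]_n -> R} := HB.pack (fun h : 'rV[R]_n => dot h v : R) LM.
have cL : continuous (L : 'rV[R]_n -> R) by move=> h; exact: continuous_dotl.
apply: (@differentiable_linear_approx _ _ _ f L x cL) => e e0.
have en0 : 0 < e / n.+1%:R by rewrite divr_gt0.
have [d d0 hd] := H _ en0.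
apply/nbhs_eball; exists d => // h; rewrite subr0 => hh.
have := hd (h + x); rewrite addrK => /(_ hh) /le_trans; apply.
rewrite -mulrA ler_pM2l // mulrC ler_pdivrMr // mulrC.
by rewrite (le_trans (enorm_le_normr h)) // ler_wpM2r // ler_nat.
Qed.

End Differentiability.

Section ConvexProjection.
Context {R : realType} {n : nat}.
Implicit Types (A M : set 'rV[R]_n) (x y z m : 'rV[R]_n) (t : R).

Lemma convex_setP A : convex_set (A : set (convex_lmodType 'rV[R]_n)) ->
  forall x y t, A x -> A y -> 0 <= t <= 1 -> A (x + t *: (y - x)).
Proof.
move=> cA x y t Ax Ay /andP[t0 t1].
have := cA y x (Itv01 t0 t1); rewrite !inE => /(_ Ay Ax).
by congr A; rewrite /conv /= /unstable.onem scalerBl scale1r scalerBr addrCA.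
Qed.

Lemma projection_dot_le0 M x z m :
  (forall x y (t : R), M x -> M y -> 0 <= t <= 1 -> M (x + t *: (y - x))) ->
  M z -> (forall y, M y -> enorm (x - z) <= enorm (x - y)) -> M m ->
  dot (x - z) (m - z) <= 0.
Proof.
move=> cM Mz zmin Mm; rewrite leNgt; apply/negP => d0.
set d := dot _ _ in d0; pose k := enorm (m - z) ^+ 2.
have k0 : 0 <= k by rewrite sqr_ge0.
have k1 : 0 < k + 1 by rewrite ltr_wpDl.
pose t := Num.min 1 (d / (k + 1)).
have t0 : 0 < t by rewrite lt_min ltr01 divr_gt0.
have t1 : t <= 1 by rewrite ge_min lexx.
have td : t * (k + 1) <= d by rewrite -ler_pdivlMr // ge_min lexx orbT.
have := zmin _ (cM z m t Mz Mm _); rewrite t1 (ltW t0) => /(_ isT).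
rewrite opprD addrA -(@ler_pXn2r _ 2) ?nnegrE // (enormD_sqr (x - z)) enormN enormZ gtr0_norm //.
rewrite exprMn -/k dotNr dotZr -/d -addrA lerDl => h.
have : t * (t * (k + 1)) <= t * d by rewrite ler_wpM2l // ltW.
have := mulr_gt0 t0 d0; have := exprn_gt0 2 t0.
by move: h; lra.
Qed.

End ConvexProjection.

Section ConvexDomain.
Context {R : realType} {n : nat} (Omega : set 'rV[R]_n).
Context (Omega_open : open Omega) (Omega_bounded : bounded_set Omega)
  (Omega_convex : convex_set (Omega : set (convex_lmodType 'rV[R]_n)))
  (bdry_neq0 : bdry Omega !=set0).
Implicit Types (x y z c w m : 'rV[R]_n) (t : R).

Local Notation rho := (inradius Omega).
Local Notation M := (high_ridge Omega).

Context (rho_gt0 : 0 < rho).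

Let d_attained := bdry_dist_attained Omega_bounded bdry_neq0.

Lemma eball_high_ridge z : M z -> eball z rho `<=` Omega.
Proof.
by move=> [Oz dz]; have := eball_bdry_dist Omega_open Oz; rewrite dz; apply.
Qed.

Lemma high_ridge_eball z : eball z rho `<=` Omega -> M z.
Proof.
move=> zO; have Oz : Omega z by apply: zO; rewrite /eball /= subrr enorm0.
split=> //; apply/eqP; rewrite eq_le le_inradius //=; last exact: subset_closure.
exact: le_bdry_dist.
Qed.

(** A point of the ball around the intermediate center lies on the segment between the corresponding
    points of the two end balls. *)
Lemma high_ridge_convex x y t : M x -> M y -> 0 <= t <= 1 -> M (x + t *: (y - x)).
Proof.
move=> Mx My t01; apply: high_ridge_eball => z zb.
pose h := z - (x + t *: (y - x)).
have -> : z = (x + h) + t *: ((y + h) - (x + h)).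
  rewrite opprD addrACA subrr addr0 addrAC /h.
  by rewrite addrC subrK.
apply: (convex_setP Omega_convex) => //.
- by apply: (eball_high_ridge Mx); rewrite /eball /= addrAC subrr add0r.
- by apply: (eball_high_ridge My); rewrite /eball /= addrAC subrr add0r.
Qed.

Lemma closed_high_ridge : closed M.
Proof.
have -> : M = closure Omega `&` [set x | rho <= bdry_dist Omega x].
  apply/seteqP; split => x.
    by move=> [Ox dx]; split; [exact: subset_closure|rewrite /= dx].
  move=> [cx /= rx]; have [Ox|dx] := (closureE_bdry x Omega_open).1 cx.
    by split=> //; apply/eqP; rewrite eq_le rx andbT; exact: le_inradius.
  by move: rx; rewrite bdry_dist_bdry // leNgt rho_gt0.
apply: closedI; first exact: closed_closure.
apply: (@preimage_closed _ _ (bdry_dist Omega) [set t | rho <= t]).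
  by move=> x _; exact: continuous_dist_to.
exact: closed_ge.
Qed.

Lemma compact_high_ridge : compact M.
Proof.
apply: (subclosed_compact closed_high_ridge (compact_closure Omega_bounded)).
by move=> x [Ox _]; exact: subset_closure.
Qed.

Context (reach : forall y, bdry Omega y -> exists2 z, M z & enorm (z - y) <= rho).

Lemma high_ridge_neq0 : M !=set0.
Proof. by have [y /reach[z Mz _]] := bdry_neq0; exists z. Qed.

Lemma high_ridge_projection x : exists z,
  [/\ M z, dist_to x M = enorm (x - z) & forall m, M m -> dot (x - z) (m - z) <= 0].
Proof.
have [z Mz dz] := dist_to_attained x compact_high_ridge high_ridge_neq0.
exists z; split=> // m Mm; apply: projection_dot_le0 Mz _ Mm.
  exact: high_ridge_convex.
by move=> y My; rewrite -dz; exact: dist_to_le.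
Qed.

(* Every point of [bdry Omega] on the normal ray from the projection [z] of [x]
   on the convex set [M] also projects on [z]. *)
Lemma normal_ray x z : Omega x -> M z -> x != z ->
  (forall m, M m -> dot (x - z) (m - z) <= 0) ->
  exists y, [/\ bdry Omega y, x != y & enorm (x - z) + enorm (x - y) = rho].
Proof.
move=> Ox Mz xz proj.
have [B hB] := (bounded_enormP Omega).1 Omega_bounded.
pose w := x - z.
have w0 : 0 < enorm w by rewrite enorm_gt0 subr_eq0.
have B0 : 0 <= B by apply: le_trans (hB x Ox).
pose S := (B + enorm x + 1) / enorm w.
have S0 : 0 < S by rewrite divr_gt0 // ltr_wpDl // addr_ge0.
have nO : ~ Omega (x + S *: w).
  move=> /hB; have := enorm_sub (S *: w) (- x).
  rewrite opprK enormN enormZ gtr0_norm // /S divfK ?gt_eqF // [S *: w + x]addrC.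
  by move=> /le_trans h /h; move: (enorm x) => k; lra.
have [t /andP[t0 _]] := segment_meets_bdry Omega_open Ox nO.
rewrite addrAC subrr add0r scalerA; set s := t * S; set y := x + s *: w => dy.
have s0 : 0 < s by rewrite mulr_gt0.
have yz : y - z = (1 + s) *: w by rewrite /y addrAC scalerDl scale1r.
have s10 : 0 < 1 + s by rewrite addr_gt0.
have yzn : enorm (y - z) = (1 + s) * enorm w by rewrite yz enormZ gtr0_norm.
have xyn : enorm (x - y) = s * enorm w.
  by rewrite /y opprD addNKr enormN enormZ gtr0_norm.
exists y; split=> //.
  by rewrite -subr_eq0 -enorm_gt0 xyn mulr_gt0.
rewrite xyn -/w; have -> : enorm w + s * enorm w = enorm (y - z) by rewrite yzn; ring.
apply/eqP; rewrite eq_le; apply/andP; split; last first.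
  by case: Mz => _ <-; rewrite enormB; exact: dist_to_le.
(* The angle at [z] is not acute, so [z'] is no closer to [y] than [z] is, and the reach of [z']
   bounds [|y - z|] by [rho]. *)
have [z' Mz' z'y] := reach dy; apply: le_trans z'y.
rewrite -(@ler_pXn2r _ 2) ?nnegrE //.
have -> : z' - y = (z' - z) - (y - z) by rewrite opprB addrA subrK.
rewrite (enormD_sqr (z' - z)) enormN dotNr yz dotZr (dotC _ w).
have := mulr_ge0_le0 (ltW s10) (proj _ Mz'); have := sqr_ge0 (enorm (z' - z)).
rewrite -/w; move: (dot _ _) (enorm _ ^+ 2) (enorm _ ^+ 2) => A C D; lra.
Qed.

(** The normal ray through [x] has length [rho] and ends on the boundary, which bounds the distance
    above; the distance is [rho] at the projection and 1-Lipschitz, which bounds it below. *)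
Lemma bdry_dist_high_ridge x : Omega x -> bdry_dist Omega x = rho - dist_to x M.
Proof.
move=> Ox; have [z [Mz -> proj]] := high_ridge_projection x.
have [->|xz] := eqVneq x z.
  by rewrite subrr enorm0 subr0; case: Mz.
have [y [dy _ e]] := normal_ray Ox Mz xz proj.
apply/eqP; rewrite eq_le; apply/andP; split.
  by apply: le_trans (dist_to_le x dy) _; rewrite -e addrAC subrr add0r.
rewrite lerBlDl; case: Mz => _ <-; rewrite enormB.
exact: dist_to_lip.
Qed.

Lemma domain_high_ridge : Omega = [set x | dist_to x M < rho].
Proof.
apply/seteqP; split=> x /=.
  move=> Ox; have := bdry_dist_gt0 Omega_open Omega_bounded bdry_neq0 Ox.
  by rewrite bdry_dist_high_ridge // subr_gt0.
have [z [Mz -> _]] := high_ridge_projection x.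
by move=> xz; apply: (eball_high_ridge Mz).
Qed.

(** The distance to [M] has gradient [(x - z) / r]: the supporting half-space of [M] at [z] bounds
    it below by its linearization, and the single competitor [z] bounds it above with the quadratic
    error [|h|^2 / (2 r)]. *)
Lemma differentiable_bdry_dist x : Omega x -> ~ M x -> differentiable (bdry_dist Omega) x.
Proof.
move=> Ox nMx; have [z [Mz dz proj]] := high_ridge_projection x.
have xz : x != z by apply/eqP => e; apply: nMx; rewrite e.
set r := enorm (x - z) in dz.
have r0 : 0 < r by rewrite enorm_gt0 subr_eq0.
apply: (@differentiable_enorm _ _ _ _ (- r^-1 *: (x - z))) => e e0.
have [d1 d10 hd1] := (open_eballP Omega).1 Omega_open x Ox.
exists (Num.min d1 (2 * r * e)); first by rewrite lt_min d10 !mulr_gt0.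
move=> y; rewrite lt_min => /andP[/hd1 Oy yd].
rewrite !bdry_dist_high_ridge // dz dotZr.
set h := y - x; pose b := dot h (x - z) / r.
have yz : y - z = h + (x - z) by rewrite /h addrA subrK.
have lower : r + b <= dist_to y M.
  apply: dist_to_ge; first exact: high_ridge_neq0.
  move=> m Mm; rewrite -(ler_pM2r r0).
  apply: le_trans (dot_le (y - m) (x - z)).
  have -> : y - m = h + (x - z) - (m - z) by rewrite -yz opprB addrA subrK.
  rewrite dotBl dotDl -[dot (x - z) (x - z)]enorm_sqr -/r (dotC (m - z)) mulrDl.
  rewrite /b divfK ?gt_eqF // -expr2 addrC -addrA lerD2l lerBrDr.
  by rewrite -[leRHS]addr0 lerD2l proj.
have upper : dist_to y M <= r + b + enorm h ^+ 2 / (2 * r).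
  apply: le_trans (dist_to_le _ Mz) _.
  have bh : - enorm h <= b.
    by rewrite ler_pdivlMr // mulNr lerNl -dotNl -(enormN h) dot_le.
  have pos : 0 <= r + b + enorm h ^+ 2 / (2 * r).
    apply: (@le_trans _ _ (((r - enorm h) ^+ 2 + r ^+ 2) / (2 * r))).
      by rewrite divr_ge0 ?addr_ge0 ?sqr_ge0 ?mulr_ge0 // ltW.
    have -> : ((r - enorm h) ^+ 2 + r ^+ 2) / (2 * r) = r - enorm h + enorm h ^+ 2 / (2 * r).
      by field; rewrite gt_eqF.
    by rewrite lerD2r lerD2l.
  rewrite -(@ler_pXn2r _ 2) ?nnegrE // yz enormD_sqr -/r.
  have -> : dot h (x - z) = b * r by rewrite /b divfK // gt_eqF.
  rewrite -subr_ge0; set H := enorm h.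
  have -> : (r + b + H ^+ 2 / (2 * r)) ^+ 2 - (H ^+ 2 + 2 * (b * r) + r ^+ 2) =
    (b + H ^+ 2 / (2 * r)) ^+ 2 by field; rewrite gt_eqF.
  exact: sqr_ge0.
have small : enorm h ^+ 2 / (2 * r) <= e * enorm h.
  rewrite ler_pdivrMr ?mulr_gt0 // expr2 mulrAC ler_wpM2r // mulrC.
  exact: ltW.
have -> : - r^-1 * dot h (x - z) = - b by rewrite mulNr mulrC.
move: lower upper small; move: (dist_to y M) (enorm h ^+ 2 / _) (_ * enorm h) => D P Q.
by move=> l1 l2 l3; rewrite ler_norml; apply/andP; split; lra.
Qed.

(** Towards a nearest boundary point the distance drops at unit rate; a two-sided derivative would
    make it grow the opposite way, beyond its maximum [rho]. *)
Lemma not_differentiable_bdry_dist x : M x -> ~ differentiable (bdry_dist Omega) x.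
Proof.
move=> Mx df; have [Ox dx] := Mx.
have [y dy dxy] := d_attained x; rewrite dx in dxy.
have := derivableP (diff_derivable (v := y - x) df).
move=> /is_derive_line0P/is_deriveP H.
set b := 'D_(y - x) _ x in H.
have r4 : 0 < rho / 4 by rewrite divr_gt0.
have [d d0 hd] := H _ r4.
have yxn : enorm (y - x) = rho by rewrite enormB.
pose t := Num.min (d / 2) (1 / 2).
have t0 : 0 < t by rewrite lt_min !divr_gt0.
have td : t < d by rewrite gt_min ltr_pdivrMr // ltr_pMr // ltr1n.
have t1 : t < 1 by rewrite gt_min; apply/orP; right; lra.
have inO s : `|s| < 1 -> Omega (s *: (y - x) + x).
  move=> s1; apply: (eball_high_ridge Mx).
  by rewrite /eball /= addrK enormZ yxn gtr_pMl.
have h1 : bdry_dist Omega (t *: (y - x) + x) <= (1 - t) * rho.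
  apply: le_trans (dist_to_le _ dy) _.
  have -> : t *: (y - x) + x - y = (t - 1) *: (y - x) by rewrite scalerBl scale1r opprB addrA.
  by rewrite enormZ yxn ler0_norm ?subr_le0 ?(ltW t1) // opprB.
have h2 : bdry_dist Omega (- t *: (y - x) + x) <= rho.
  apply: le_inradius => //; apply: subset_closure; apply: inO.
  by rewrite normrN gtr0_norm.
have := hd t; have := hd (- t).
rewrite !subr0 !scale0r !add0r dx normrN gtr0_norm // => /(_ td) + /(_ td).
move: h1 h2; move: (bdry_dist _ _) (bdry_dist _ _) => P Q hQ hP.
rewrite !ler_norml => /andP[l1 l2] /andP[l3 l4].
have rt := mulr_gt0 rho_gt0 t0.
by move: l1 l2 l3 l4 hP hQ rt; lra.
Qed.

Lemma cut_locus_high_ridge : cut_locus Omega = M.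
Proof.
rewrite /cut_locus; have -> : singular_set Omega = M.
  apply/seteqP; split=> x.
    by move=> [Ox nd]; apply: contrapT => nMx; apply: nd; exact: differentiable_bdry_dist.
  by move=> Mx; split; [case: Mx|exact: not_differentiable_bdry_dist].
by rewrite -(closure_id M).1 //; exact: closed_high_ridge.
Qed.

(** If [x] lay beyond the tangent hyperplane, the line from [x] through [c + w] would enter the
    ball, and [c + w] would be a convex combination of points of [Omega]. *)
Lemma supporting_hyperplane c w x : eball c rho `<=` Omega -> enorm w = rho ->
  bdry Omega (c + w) -> Omega x -> dot (x - c) w <= rho ^+ 2.
Proof.
move=> cO wr dp Ox; rewrite leNgt; apply/negP => h.
apply: (bdry_notin Omega_open dp).
pose v := x - (c + w); pose d := dot v w; pose k := enorm v ^+ 2.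
have d0 : 0 < d by rewrite /d /v opprD addrA dotBl -enorm_sqr wr subr_gt0.
have k0 : 0 <= k by rewrite sqr_ge0.
have k1 : 0 < k + 1 by rewrite ltr_wpDl.
(* Small enough for [|w - s v|^2 = rho^2 - 2 s d + s^2 k] to be below [rho^2]. *)
pose s := d / (k + 1).
have s0 : 0 < s by rewrite divr_gt0.
have b : Omega (c + w - s *: v).
  apply: cO; rewrite /eball /= addrAC (addrAC c) subrr add0r.
  rewrite -(@ltr_pXn2r _ 2) ?nnegrE ?(ltW rho_gt0) // enormD_sqr wr dotNr dotZr.
  rewrite enormN enormZ gtr0_norm // exprMn (dotC w) -/d -/k.
  have e : d = s * (k + 1) by rewrite /s divfK // gt_eqF.
  rewrite [in _ * d]e -addrA gtrDl.
  have := mulr_ge0 (sqr_ge0 s) k0; have := exprn_gt0 2 s0; lra.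
have s10 : 0 < 1 + s by rewrite addr_gt0.
have := convex_setP Omega_convex (t := s / (1 + s)) b Ox.
have -> : c + w - s *: v + (s / (1 + s)) *: (x - (c + w - s *: v)) = c + w.
  have -> : x - (c + w - s *: v) = (1 + s) *: v.
    by rewrite scalerDl scale1r opprB addrCA addrC.
  by rewrite scalerA divfK ?gt_eqF // subrK.
by apply; rewrite divr_ge0 ?(ltW s0) ?(ltW s10) //= ler_pdivrMr // mul1r lerDr.
Qed.

(** The ball of radius [rho] around [z] stays behind the hyperplane tangent to the equal ball around
    [c], so [z] cannot be ahead of [c] in direction [w]. *)
Lemma high_ridge_slab c w z : eball c rho `<=` Omega -> enorm w = rho ->
  bdry Omega (c + w) -> M z -> dot (z - c) w <= 0.
Proof.
move=> cO wr dp Mz.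
have key s : 0 <= s < 1 -> dot (z - c) w + s * rho ^+ 2 <= rho ^+ 2.
  move=> /andP[s0 s1].
  have Os : Omega (z + s *: w).
    apply: (eball_high_ridge Mz); rewrite /eball /= addrAC subrr add0r enormZ wr.
    by rewrite ger0_norm // gtr_pMl.
  have := supporting_hyperplane cO wr dp Os.
  by rewrite addrAC (dotDl (z - c)) dotZl -enorm_sqr wr.
rewrite leNgt; apply/negP => h.
have r20 : 0 < rho ^+ 2 by rewrite exprn_gt0.
set D := dot _ _ in h key.
(* Replaces the limit [s -> 1]; the maximum keeps [s] nonnegative. *)
pose s := Num.max 0 (1 - D / (2 * rho ^+ 2)).
have : D + s * rho ^+ 2 <= rho ^+ 2.
  by apply: key; rewrite le_max lexx gt_max ltr01 gtrBl divr_gt0 // mulr_gt0.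
have : (1 - D / (2 * rho ^+ 2)) * rho ^+ 2 <= s * rho ^+ 2.
  by rewrite ler_wpM2r ?(ltW r20) // le_max lexx orbT.
have -> : (1 - D / (2 * rho ^+ 2)) * rho ^+ 2 = rho ^+ 2 - D / 2.
  by field; rewrite gt_eqF.
clearbody D; move: h; clear; move: (s) (rho ^+ 2) => S P h h1 h2; lra.
Qed.

End ConvexDomain.

(** A point [c + (2 t - 1) w] of the diameter is on the sphere only for [2 t - 1] equal to 1 or -1,
    so two distinct ones are its two ends. *)
Lemma antipodal_touching {R : realType} {n : nat} (Omega : set 'rV[R]_n) c r :
  0 < r -> touches_at_diameter Omega c r ->
  exists w, [/\ enorm w = r, bdry Omega (c + w) & bdry Omega (c - w)].
Proof.
move=> r0 [p [q [w [pq [/bdry_eball pc dp] [/bdry_eball qc dq] wr [sp sq]]]]].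
have ends x : enorm (x - c) = r -> line_segment (c - w) (c + w) x -> x = c + w \/ x = c - w.
  move=> xc [t _ e]; move: xc; rewrite -e.
  have -> : c - w + t *: (c + w - (c - w)) = c + (2 * t - 1) *: w.
    rewrite opprB [c + w]addrC addrACA subrr addr0 -mulr2n -scaler_nat scalerA.
    by rewrite scalerBl scale1r -addrA [- w + _]addrC [t * _]mulrC.
  rewrite addrAC subrr add0r enormZ wr => /eqP; rewrite -subr_eq0 -{2}[r]mul1r -mulrBl mulf_eq0.
  rewrite (gt_eqF r0) orbF subr_eq0 eqr_norml ler01 andbT => /orP[/eqP->|/eqP->].
    by left; rewrite scale1r.
  by right; rewrite scaleN1r.
have [pe|pe] := ends p pc sp; have [qe|qe] := ends q qc sq.
- by rewrite pe qe eqxx in pq.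
- by exists w; split; rewrite // -?pe -?qe.
- by exists w; split; rewrite // -?pe -?qe.
- by rewrite pe qe eqxx in pq.
Qed.

Lemma planar_segment {R : realType} (M : set 'rV[R]_2) (c w : 'rV[R]_2) :
  w != 0 -> compact M -> M !=set0 ->
  (forall x y (t : R), M x -> M y -> 0 <= t <= 1 -> M (x + t *: (y - x))) ->
  (forall z, M z -> dot (z - c) w = 0) ->
  exists p q, M = line_segment p q.
Proof.
move=> w0 cM M0 convM Mw.
(* [w] rotated by a quarter turn. It spans the line orthogonal to [w], so [dot _ v] is a coordinate
   on [M], and its extreme points are the ends of the segment. *)
pose v : 'rV[R]_2 := \row_i (if i == 0 then - w 0 1 else w 0 0).
have w20 : 0 < dot w w by rewrite -enorm_sqr exprn_gt0 // enorm_gt0.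
have along x : dot x w = 0 -> x = (dot x v / dot w w) *: v.
  move=> xw; have := w20; move: xw; rewrite /dot !big_ord_recl !big_ord0 !addr0 !mxE /=.
  have -> : lift ord0 (ord0 : 'I_1) = 1 :> 'I_2 by apply: val_inj.
  move=> xw ww; apply/rowP => i; rewrite !mxE.
  have wn0 := gt_eqF ww.
  have i01 : i = 0 \/ i = 1.
    by case: i => [[|[|//]] hi]; [left|right]; apply: val_inj.
  case: i01 => ->; apply: (mulIf (negbT wn0)) => /=; rewrite mulrAC divfK ?wn0 //; apply/subr0_eq.
    transitivity (w 0 0 * (x 0 0 * w 0 0 + x 0 1 * w 0 1)); last by rewrite xw mulr0.
    ring.
  transitivity (w 0 1 * (x 0 0 * w 0 0 + x 0 1 * w 0 1)); last by rewrite xw mulr0.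
  ring.
have cf : {within M, continuous (fun x => dot x v)}.
  by apply: continuous_subspaceT; exact: continuous_dotl.
have [p + pmin] := EVT_min_rV M0 cM cf; rewrite inE => Mp.
have [q + qmax] := EVT_max_rV M0 cM cf; rewrite inE => Mq.
have diff x : M x -> x - p = ((dot x v - dot p v) / dot w w) *: v.
  move=> Mx; rewrite -dotBl; apply: along.
  have -> : x - p = (x - c) - (p - c) by rewrite opprB addrA subrK.
  by rewrite dotBl !Mw // subr0.
exists p, q; apply/seteqP; split=> [x Mx|x [t t01 <-]]; last exact: convM.
have px : dot p v <= dot x v by apply: pmin; rewrite inE.
have xq : dot x v <= dot q v by apply: qmax; rewrite inE.
have [pq|pq] := eqVneq (dot p v) (dot q v).
  exists 0; rewrite /= ?lexx ?ler01 // scale0r addr0.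
  apply/esym/eqP; rewrite -subr_eq0 diff //.
  have -> : dot x v = dot p v by apply/eqP; rewrite eq_le px andbT pq xq.
  by rewrite subrr mul0r scale0r.
have pqlt : 0 < dot q v - dot p v by rewrite subr_gt0 lt_neqAle pq (le_trans px).
exists ((dot x v - dot p v) / (dot q v - dot p v)).
  by rewrite /= divr_ge0 ?subr_ge0 ?(ltW pqlt) ?(le_trans px) //= ler_pdivrMr // mul1r lerD2r.
rewrite (diff q) // scalerA mulrA divfK ?gt_eqF // -diff // subrKC //.
Qed.

(** * Failure of C^2 regularity *)

Section SecondOrder.
Context {R : realType}.

(** Dividing by [t] kills [A], then dividing by [t^2] kills [B]. Only positive [t] are tested, since
    the boundary will be known to be flat on one side only. *)
Lemma quadratic_little_o (A B : R) :
  (forall e : R, 0 < e -> exists2 d : R, 0 < d & forall t, 0 < t < d ->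
    `|A * t + B * t ^+ 2| <= e * t ^+ 2) -> A = 0 /\ B = 0.
Proof.
move=> H.
have A0 : A = 0.
  have [d d0 hd] := H 1 ltr01.
  have k0 : 0 < `|B| + 1 by rewrite ltr_wpDl.
  apply/eqP; rewrite -normr_le0; apply/ler_addgt0Pl => e e0; rewrite addr0.
  pose t := Num.min (d / 2) (e / (`|B| + 1)).
  have t0 : 0 < t by rewrite lt_min !divr_gt0.
  have td : t < d by rewrite gt_min ltr_pdivrMr // ltr_pMr // ltr1n.
  have te : t * (`|B| + 1) <= e by rewrite -ler_pdivlMr // ge_min lexx orbT.
  apply: le_trans te; rewrite -(ler_pM2r t0) -[X in _ * X <= _](gtr0_norm t0) -normrM.
  have -> : A * t = (A * t + B * t ^+ 2) - B * t ^+ 2 by ring.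
  apply: le_trans (ler_normB _ _) _.
  have := hd t; rewrite t0 td => /(_ isT) h.
  have -> : t * (`|B| + 1) * t = 1 * t ^+ 2 + `|B| * t ^+ 2 by ring.
  by rewrite lerD // normrM (ger0_norm (sqr_ge0 t)).
split=> //; apply/eqP; rewrite -normr_le0; apply/ler_addgt0Pl => e e0; rewrite addr0.
have [d d0 hd] := H e e0.
have t0 : 0 < d / 2 by rewrite divr_gt0.
have := hd (d / 2); rewrite t0 ltr_pdivrMr // ltr_pMr // ltr1n => /(_ isT).
by rewrite A0 mul0r add0r normrM (ger0_norm (sqr_ge0 _)) ler_pM2r // exprn_gt0.
Qed.

End SecondOrder.

Section C2Line.
Context {R : realType} {n : nat}.
Implicit Types (f : 'rV[R]_n -> R) (x v : 'rV[R]_n).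

(** [b] is half the second derivative along [v]; it is left existential because the flat side of the
    boundary will force it to be 0. *)
Lemma C2_line_taylor f x v : C2_on setT f ->
  exists b, forall e : R, 0 < e -> exists2 d : R, 0 < d & forall t, `|t| < d ->
    `|f (x + t *: v) - f x - dot (gradient f x) v * t - b * t ^+ 2| <= e * t ^+ 2.
Proof.
move=> [C1f C2f].
pose h1 t := dot (gradient f (t *: v + x)) v.
pose b := \sum_j dot (gradient (partial j f) x) v * v 0 j.
have d1 (t : R) : is_derive t 1 (fun s : R => f (s *: v + x)) (h1 t).
  by apply/is_derive_lineP; apply: (C1_on_is_derive v (@openT _) C1f).
have d2 : is_derive (0 : R) 1 h1 b.
  have -> : h1 = \sum_j (fun t : R => partial j f (t *: v + x) * v 0 j).
    apply/funext => t; rewrite fct_sumE; apply: eq_bigr => j _; rewrite mxE //.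
  apply: is_derive_sum => j.
  have dj : is_derive (0 : R) 1 (fun t : R => partial j f (t *: v + x))
      (dot (gradient (partial j f) x) v).
    apply/is_derive_line0P; exact: (C1_on_is_derive v (@openT _) (C2f j)).
  apply: is_derive_eq; rewrite /GRing.scale /=; ring.
exists (b / 2) => e e0.
have [|d d0 hd] := taylor2 (h := fun s => f (s *: v + x)) (h1 := h1) _ d2 e0.
  by near=> t; exact: d1.
exists d => // t td; have := hd t; rewrite !subr0 => /(_ td).
by rewrite /h1 scale0r add0r [x + _]addrC.
Unshelve. all: by end_near.
Qed.

End C2Line.

Section NotC2.
Context {R : realType} {n : nat} (Omega : set 'rV[R]_n).
Context (Omega_open : open Omega) (Omega_C2 : C2_domain Omega).
Implicit Types (x y v w k : 'rV[R]_n).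

(** A C^2 defining function that vanishes along [- v] has zero first and second derivatives along
    [v], so it is of order below [t^2] at [y + t v]. Sinking by [mu t^2] in the inward direction
    [- w] gains a multiple of [t^2] and enters [Omega], which the last hypothesis forbids. *)
Lemma flat_then_parabola_not_C2 y v w (mu : R) : 0 < mu ->
  (forall t, 0 <= t <= 1 -> bdry Omega (y - t *: v)) ->
  (forall k, dot k w < 0 ->
    exists2 t0, 0 < t0 & forall t, 0 < t <= t0 -> Omega (y + t *: k)) ->
  w != 0 ->
  ~ (forall t, 0 < t -> ~ Omega (y + t *: v - (mu * t ^+ 2) *: w)).
Proof.
move=> mu0 flat cone w0 outside.
have dy : bdry Omega y by have := flat 0; rewrite scale0r subr0 lexx ler01; apply.
have [r [i [s [g [r0 C2g graph]]]]] := Omega_C2 dy.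
pose P := col' i y.
pose sg : R := (-1) ^+ s.
(* Near [y], [F] is positive exactly on [Omega]; [L] is its differential at [y]. *)
pose F x := sg * x 0 i - g (col' i x).
pose L k := sg * k 0 i - dot (gradient g P) (col' i k).
have colD a b : col' i (a + b : 'rV[R]_n) = col' i a + col' i b by apply/rowP => j; rewrite !mxE.
have colZ t a : col' i (t *: a : 'rV[R]_n) = t *: col' i a by apply/rowP => j; rewrite !mxE.
have colB p q : col' i (p - q : 'rV[R]_n) = col' i p - col' i q.
  by rewrite colD -scaleN1r colZ scaleN1r.
have LD a b : L (a + b) = L a + L b by rewrite /L colD dotDr mxE; ring.
have LZ t a : L (t *: a) = t * L a by rewrite /L colZ dotZr mxE; ring.
have col_le a : enorm (col' i a : 'rV[R]_n.-1) <= n%:R * enorm (a : 'rV[R]_n).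
  apply: le_trans (enorm_le_normr _) _; apply: ler_pM => //.
    by rewrite ler_nat leq_pred.
  apply: normr_le_coord => // j; rewrite mxE.
  exact: le_trans (normr_coord_le _ _) (normr_le_enorm _).
have n1 : 0 < n.+1%:R :> R by [].
have strict e : 0 < e -> exists2 d : R, 0 < d & forall a b,
    enorm (a - y) < d -> enorm (b - y) < d ->
    `|F b - F a - L (b - a)| <= e * enorm (b - a).
  move=> e0; have en0 : 0 < e / n.+1%:R by rewrite divr_gt0.
  have [d d0 hd] := C1_on_strict (@openT _) C2g.1 (I : setT P) en0.
  exists (d / n.+1%:R) => [|a b]; first by rewrite divr_gt0.
  have cl p : enorm (p - y) < d / n.+1%:R -> enorm (col' i p - P) < d.
    rewrite ltr_pdivlMr // mulrC /P -colB => h; apply: le_lt_trans (col_le _) _.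
    by apply: le_lt_trans h; rewrite ler_wpM2r // ler_nat.
  move=> /cl ha /cl hb; have := hd _ _ ha hb; rewrite -colB.
  have -> : F b - F a - L (b - a) =
      - (g (col' i b) - g (col' i a) - dot (gradient g P) (col' i (b - a))).
    by rewrite /F /L !mxE; ring.
  rewrite normrN => /le_trans; apply; rewrite -mulrA ler_pM2l // mulrC ler_pdivrMr // mulrC.
  by apply: le_trans (col_le _) _; rewrite ler_wpM2r // ler_nat.
have inF x : enorm (x - y) < r -> Omega x <-> 0 < F x.
  by move=> xr; rewrite /F subr_gt0; apply: graph.
have F_bdry x : enorm (x - y) < r -> bdry Omega x -> F x = 0.
  move=> xr dx; apply/eqP; rewrite eq_le; apply/andP; split.
    rewrite leNgt; apply/negP => /(inF x xr).2; exact: bdry_notin dx.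
  rewrite leNgt; apply/negP => Fx.
  have cF : {for x, continuous F}.
    apply/continuous_eballP => e e0.
    have e20 : 0 < e / 2 by rewrite divr_gt0.
    have := C1_on_continuous (@openT _) C2g.1 (I : setT (col' i x)).
    move=> /continuous_eballP/(_ _ e20)[d d0 hd].
    exists (Num.min (e / 2) (d / n.+1%:R)); first by rewrite lt_min e20 divr_gt0.
    move=> z; rewrite lt_min [X in _ && X]ltr_pdivlMr // => /andP[ze zd].
    have hg := hd (col' i z) _; rewrite -colB in hg.
    have zi : `|sg * z 0 i - sg * x 0 i| < e / 2.
      rewrite -mulrBr normrM normr_sign mul1r.
      have := normr_coord_le (z - x) i; rewrite !mxE => /le_lt_trans; apply.
      by apply: le_lt_trans ze; exact: normr_le_enorm.
    rewrite /F; have -> : sg * z 0 i - g (col' i z) - (sg * x 0 i - g (col' i x)) =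
      (sg * z 0 i - sg * x 0 i) - (g (col' i z) - g (col' i x)) by ring.
    rewrite [ltRHS]splitr; apply: le_lt_trans (ler_normB _ _) _; rewrite ltrD //.
    apply: hg; apply: le_lt_trans (col_le _) _; apply: le_lt_trans zd.
    by rewrite mulrC ler_wpM2l // ler_nat.
  have Fx0 : 0 < - F x by rewrite oppr_gt0.
  have [d d0 hd] := (continuous_eballP _ _).1 cF _ Fx0.
  have xr0 : 0 < r - enorm (x - y) by rewrite subr_gt0.
  have := (closure_eballP Omega x).1 (bdry_closure dx) (Num.min d (r - enorm (x - y))).
  rewrite lt_min d0 xr0 => /(_ isT)[z Oz]; rewrite lt_min => /andP[zd zr].
  have zy : enorm (z - y) < r.
    by apply: le_lt_trans (enorm_triangle x _ _) _; rewrite -ltrBrDr.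
  have Fz := (inF z zy).1 Oz.
  have := ltW (hd z zd); rewrite ler_norml opprK => /andP[_].
  by rewrite lerBlDr addNr leNgt Fz.
have Fy : F y = 0 by apply: F_bdry; rewrite ?subrr ?enorm0.
have L_ge0 k : dot k w < 0 -> 0 <= L k.
  move=> /cone[t0 t00 inO]; apply/ler_addgt0Pl => e e0.
  have k1 : 0 < enorm k + 1 by rewrite ltr_wpDl.
  have ek : 0 < e / (enorm k + 1) by rewrite divr_gt0.
  have [d d0 hd] := strict _ ek.
  pose t := Num.min t0 (Num.min d r / (2 * (enorm k + 1))).
  have m0 : 0 < Num.min d r by rewrite lt_min d0.
  have tp : 0 < t by rewrite lt_min t00 divr_gt0 // mulr_gt0.
  have tk : t * enorm k < Num.min d r.
    have : t * (2 * (enorm k + 1)) <= Num.min d r.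
      by rewrite -ler_pdivlMr ?mulr_gt0 // ge_min lexx orbT.
    apply: lt_le_trans; rewrite ltr_pM2l //.
    by have := enorm_ge0 k; move: (enorm k) => q; lra.
  have yt : enorm (y + t *: k - y) = t * enorm k.
    by rewrite addrAC subrr add0r enormZ gtr0_norm.
  move: tk; rewrite lt_min => /andP[td tr].
  have Ft : 0 < F (y + t *: k).
    by apply/inF; [rewrite yt|apply: inO; rewrite tp ge_min lexx].
  have := hd y (y + t *: k); rewrite subrr enorm0 yt => /(_ d0 td).
  rewrite Fy subr0 [y + _]addrC addrK LZ [_ + y]addrC ler_norml => /andP[_ h].
  rewrite -(ler_pM2l tp) mulr0 mulrDr.
  have h2 : e / (enorm k + 1) * (t * enorm k) <= t * e.
    rewrite mulrCA ler_pM2l // mulrAC ler_pdivrMr // ler_pM2l // lerDl //.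
  by move: h h2 Ft; move: (F _) (_ / _ * _) (t * e) (t * L k) => X1 X2 X3 X4; lra.
have L_w : 0 < L (- w).
  (* The cone yields only [0 <= L] on an open half-space. As [L k0 = 1] and [- w - ep *: k0] is
     still in that half-space, the sign at [- w] is strict. *)
  pose k0 : 'rV[R]_n := sg *: delta_mx 0 i.
  have Lk0 : L k0 = 1.
    rewrite LZ /L; have -> : col' i (delta_mx 0 i) = 0 :> 'rV[R]_n.-1.
      by apply/rowP => j; rewrite !mxE eqxx /= eq_sym (negPf (neq_lift _ _)).
    by rewrite dot0r mxE !eqxx subr0 mulr1 -expr2 sqrr_sign.
  have w2 : 0 < dot w w by rewrite -enorm_sqr exprn_gt0 // enorm_gt0.
  have q0 : 0 < `|dot k0 w| + 1 by rewrite ltr_wpDl.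
  pose ep := dot w w / (`|dot k0 w| + 1).
  have ep0 : 0 < ep by rewrite divr_gt0.
  have := L_ge0 (- w - ep *: k0); rewrite dotBl dotNl dotZl.
  have : - (ep * dot k0 w) < dot w w.
    have -> : dot w w = ep * (`|dot k0 w| + 1) by rewrite divfK // gt_eqF.
    rewrite -mulrN ltr_pM2l // ltr_pwDr // -normrN; exact: ler_norm.
  have -> : L (- w - ep *: k0) = L (- w) - ep.
    by rewrite -scaleNr LD LZ Lk0; ring.
  move=> h1 h2; have : 0 <= L (- w) - ep by apply: h2; move: h1; lra.
  by rewrite subr_ge0; exact: lt_le_trans.
have FL t : F (y + t *: v) = sg * v 0 i * t - (g (P + t *: col' i v) - g P).
  have := Fy; rewrite /F colD colZ !mxE -/P => e.
  by rewrite -[LHS]subr0 -e; ring.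
have [b hb] := C2_line_taylor P (col' i v) C2g.
have Ft e : 0 < e -> exists2 d : R, 0 < d & forall t, `|t| < d ->
    `|F (y + t *: v) - L v * t + b * t ^+ 2| <= e * t ^+ 2.
  move=> /hb[d d0 hd]; exists d => // t /hd; rewrite FL /L -normrN.
  by congr (`|_| <= _); ring.
have [Lv b0] : L v = 0 /\ b = 0.
  apply: quadratic_little_o => e /Ft[d d0 hd].
  have vk : 0 < enorm v + 1 by rewrite ltr_wpDl.
  exists (Num.min d (Num.min 1 (r / (enorm v + 1)))).
    by rewrite !lt_min d0 ltr01 divr_gt0.
  move=> t /andP[t0]; rewrite !lt_min ltr_pdivlMr // => /and3P[td t1 tr].
  have := hd (- t); rewrite normrN gtr0_norm // => /(_ td).
  rewrite scaleNr F_bdry; last 2 first.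
  - rewrite addrAC subrr sub0r enormN enormZ gtr0_norm //.
    by apply: le_lt_trans tr; rewrite ler_wpM2l ?(ltW t0) // lerDl.
  - by apply: flat; rewrite !ltW.
  by rewrite sqrrN sub0r mulrN opprK.
have mw : 0 < 1 + mu * enorm w by rewrite addr_gt0 // mulr_gt0 // enorm_gt0.
(* The errors are [e t^2] along [v] and [e mu t^2 |w|] along [- w]; this [e] makes their sum half of
   the gain [mu t^2 L (- w)]. *)
have [e e0 E] : exists2 e, 0 < e & e * (1 + mu * enorm w) = mu * L (- w) / 2.
  exists (mu * L (- w) / (2 * (1 + mu * enorm w))); first by rewrite divr_gt0 ?mulr_gt0.
  by field; rewrite gt_eqF.
have [d1 d10 hd1] := Ft e e0; have [d2 d20 hd2] := strict e e0.
pose m := Num.min d2 r.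
have m0 : 0 < m by rewrite lt_min d20.
pose K := 2 * (enorm v + mu * enorm w + 1).
have K0 : 0 < K by rewrite mulr_gt0 // ltr_wpDl // addr_ge0 // mulr_ge0 // ltW.
pose t := Num.min (1 / 2) (Num.min (d1 / 2) (m / K)).
have t0 : 0 < t by rewrite !lt_min !divr_gt0.
have t1 : t <= 1 by rewrite ge_min; apply/orP; left; lra.
have td1 : t < d1.
  by rewrite !gt_min; apply/orP; right; apply/orP; left; move: d10; lra.
have tK : t * K <= m by rewrite -ler_pdivlMr // !ge_min lexx !orbT.
apply: (outside t t0); set x1 := y + t *: v; set x2 := x1 - _.
have x21 : x2 - x1 = (mu * t ^+ 2) *: (- w).
  by rewrite /x2 addrAC subrr sub0r scalerN.
have nx21 : enorm (x2 - x1) = mu * t ^+ 2 * enorm w.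
  by rewrite x21 enormZ enormN gtr0_norm // mulr_gt0 // exprn_gt0.
have nx1 : enorm (x1 - y) = t * enorm v.
  by rewrite /x1 addrAC subrr add0r enormZ gtr0_norm.
have t2 : t ^+ 2 <= t by rewrite expr2 ger_pMr.
have wt : mu * t ^+ 2 * enorm w <= t * (mu * enorm w).
  by rewrite mulrAC mulrC ler_wpM2r // mulr_ge0 // ltW.
have hv : t * enorm v + t * (mu * enorm w) < m.
  apply: lt_le_trans tK; rewrite -mulrDr ltr_pM2l // /K.
  have : 0 <= enorm v + mu * enorm w by rewrite addr_ge0 // mulr_ge0 // ltW.
  by move: (_ + _) => q; lra.
have x1m : enorm (x1 - y) < m.
  rewrite nx1; apply: le_lt_trans hv; rewrite lerDl.
  by rewrite !mulr_ge0 // ltW.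
have x2m : enorm (x2 - y) < m.
  apply: le_lt_trans (enorm_triangle x1 _ _) _; rewrite nx21 nx1 addrC.
  by apply: le_lt_trans hv; rewrite lerD2l.
move: x1m x2m; rewrite !lt_min => /andP[x1d x1r] /andP[x2d x2r].
apply/inF => //.
have := hd2 x1 x2 x1d x2d; rewrite nx21 x21 LZ ler_norml => /andP[h1 _].
have := hd1 t; rewrite gtr0_norm // => /(_ td1).
rewrite Lv b0 !mul0r subr0 addr0 -/x1 ler_norml => /andP[h2 _].
have tt : 0 < t ^+ 2 by rewrite exprn_gt0.
have pos := mulr_gt0 tt (mulr_gt0 mu0 L_w).
have E2 : t ^+ 2 * (e * (1 + mu * enorm w)) = t ^+ 2 * (mu * L (- w)) / 2 by rewrite E mulrA.
move: h1 h2 E2 pos; move: (F x1) (F x2) (L (- w)) (enorm w) => f1 f2 l q.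
by lra.
Qed.

End NotC2.

(** * Conclusion *)

Section SmoothStadium.
Context {R : realType} {n : nat} (Omega : set 'rV[R]_n) (c w : 'rV[R]_n).
Local Notation rho := (inradius Omega).
Local Notation M := (high_ridge Omega).
Context (Omega_open : open Omega) (Omega_bounded : bounded_set Omega)
  (Omega_convex : convex_set (Omega : set (convex_lmodType 'rV[R]_n)))
  (bdry_neq0 : bdry Omega !=set0) (rho_gt0 : 0 < rho)
  (reach : forall y, bdry Omega y -> exists2 z, M z & enorm (z - y) <= rho)
  (cM : M c) (w_rho : enorm w = rho) (M_perp : forall z, M z -> dot (z - c) w = 0).

Lemma high_ridge_near x : Omega x -> exists2 z, M z & enorm (x - z) < rho.
Proof.
move=> Ox.
have [z [Mz dz _]] := high_ridge_projection Omega_open Omega_bounded Omega_convex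
  bdry_neq0 rho_gt0 reach x.
exists z => //; rewrite -dz.
by move: Ox; rewrite {1}(domain_high_ridge Omega_open Omega_bounded Omega_convex
  bdry_neq0 rho_gt0 reach).
Qed.

(** Ridge points differ from [z] orthogonally to [w], so all are at distance at least [rho] from
    [z + w], which is thus outside [Omega] but on the sphere around [z]. *)
Lemma bdry_top z : M z -> bdry Omega (z + w).
Proof.
move=> Mz.
have r20 : 0 < rho ^+ 2 by rewrite exprn_gt0.
split.
  apply/closure_eballP => e e0.
  pose t := Num.min 1 (e / (2 * rho)).
  have t0 : 0 < t by rewrite lt_min ltr01 divr_gt0 // mulr_gt0.
  have t1 : t <= 1 by rewrite ge_min lexx.
  have te : t * (2 * rho) <= e by rewrite -ler_pdivlMr ?mulr_gt0 // ge_min lexx orbT.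
  exists (z + (1 - t) *: w).
    apply: (eball_high_ridge Omega_open Mz).
    rewrite /eball /= addrAC subrr add0r enormZ w_rho ger0_norm ?subr_ge0 //.
    by rewrite gtr_pMl // ltrBlDr ltrDl.
  rewrite opprD addrACA subrr add0r scalerBl scale1r addrAC subrr add0r.
  rewrite enormN enormZ w_rho gtr0_norm //; apply: lt_le_trans te.
  by rewrite ltr_pM2l // ltr_pMl // ltr1n.
rewrite ((interior_id Omega).1 Omega_open) => /high_ridge_near[m Mm h].
have := dot_le (z + w - m) w.
have -> : z + w - m = (z - c) - (m - c) + w by rewrite opprB addrA subrK addrAC.
rewrite dotDl dotBl !M_perp // subrr add0r -enorm_sqr w_rho expr2 ler_pM2r //.
rewrite leNgt => /negP; apply.
by have -> : z - c - (m - c) + w = z + w - m by rewrite opprB addrA subrK addrAC.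
Qed.

Lemma C2_high_ridge : C2_domain Omega -> forall z, M z -> z = c.
Proof.
move=> C2.
have cf : {within M, continuous (fun x => enorm (x - c))}.
  by apply: continuous_subspaceT; exact: continuous_enorm_sub.
have cptM := compact_high_ridge Omega_open Omega_bounded bdry_neq0 rho_gt0.
have [|z + zmax] := EVT_max_rV _ cptM cf; first by exists c.
rewrite inE => Mz.
have [zc|zc] := eqVneq z c.
  move=> m Mm; apply/eqP; rewrite -subr_eq0 -enorm_eq0 eq_le enorm_ge0 andbT.
  by have := zmax m; rewrite zc subrr enorm0; apply; rewrite inE.
exfalso.
pose v := z - c; pose D := enorm v ^+ 2.
have D0 : 0 < D by rewrite exprn_gt0 // enorm_gt0 subr_eq0.
have r20 : 0 < rho ^+ 2 by rewrite exprn_gt0.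
(* Moving by [t v] adds at least [t^2 D] to the squared distance from the ridge, while sinking by
   [mu t^2 w] removes at most [2 mu t^2 rho^2]; the two balance. *)
pose mu := D / (2 * rho ^+ 2).
have mu0 : 0 < mu by rewrite divr_gt0 // mulr_gt0.
have ball_z := eball_high_ridge Omega_open Mz.
apply: (@flat_then_parabola_not_C2 _ _ Omega Omega_open C2 (z + w) v w mu mu0).
- move=> t t01; have -> : z + w - t *: v = (z + t *: (c - z)) + w.
    by rewrite addrAC -scalerN opprB.
  apply: bdry_top.
  exact: (high_ridge_convex Omega_open Omega_bounded Omega_convex bdry_neq0).
- move=> k kw; apply: (ball_direction ball_z); first by rewrite addrAC subrr add0r.
  by rewrite opprD addNKr dotNr oppr_gt0.
- by rewrite -enorm_gt0 w_rho.
move=> t t0 /high_ridge_near[m Mm]; rewrite ltNge => /negP; apply.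
set mt := mu * t ^+ 2.
have -> : z + w + t *: v - mt *: w - m = (z - m + t *: v) + (1 - mt) *: w.
  rewrite scalerBl scale1r; move: (t *: v) (mt *: w) => a b.
  by apply/rowP => j; rewrite !mxE; ring.
have zm : dot (z - m) w = 0.
  have -> : z - m = (z - c) - (m - c) by rewrite opprB addrA subrK.
  by rewrite dotBl !M_perp // subrr.
rewrite -(@ler_pXn2r _ 2) ?nnegrE ?(ltW rho_gt0) // (enormD_sqr (_ + _)).
rewrite dotZr dotDl dotZl zm M_perp // mulr0 addr0 !mulr0 addr0.
rewrite enormZ exprMn real_normK ?num_real // w_rho (enormD_sqr (z - m)) dotZr.
rewrite enormZ gtr0_norm // exprMn -/D.
(* Here the choice of [z] enters: no ridge point is farther from [c], so none lies beyond [z] in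
   direction [v]. *)
have zmv : 0 <= dot (z - m) v.
  have -> : z - m = v - (m - c) by rewrite /v opprB addrA subrK.
  rewrite dotBl subr_ge0 -enorm_sqr expr2 (le_trans (dot_le _ _)) // ler_wpM2r //.
  by apply: zmax; rewrite inE.
have zm2 := sqr_ge0 (enorm (z - m)).
have E : t ^+ 2 * D = 2 * mt * rho ^+ 2 by rewrite /mt /mu; field; rewrite gt_eqF.
rewrite E; have := mulr_ge0 (ltW t0) zmv.
have := mulr_ge0 (sqr_ge0 mt) (ltW r20).
move: zm2; move: (t * _) (enorm _ ^+ 2) (rho ^+ 2) => A B C.
by lra.
Qed.

End SmoothStadium.

Theorem corollary23 (R : realType) (n : nat) (Omega : set 'rV[R]_n) (a : R)
    (Omega_neq0 : Omega !=set0)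
    (Omega_open : open Omega)
    (Omega_bounded : bounded_set Omega)
    (Omega_convex : convex_set (Omega : set (convex_lmodType 'rV[R]_n)))
    (Omega_sphere : interior_sphere_condition Omega)
    (u : 'rV[R]_n -> R)
    (u_solution : dirichlet_solution Omega u)
    (delta : R) (delta_gt0 : 0 < delta)
    (G : 'rV[R]_n -> 'rV[R]_n)
    (u_C1 : C1_up_to_bdry Omega delta u G)
    (inner_ball : exists c : 'rV[R]_n,
       eball c (inradius Omega) `<=` Omega /\
       touches_at_diameter Omega c (inradius Omega))
    (u_overdetermined : forall x, bdry Omega x -> enorm (G x) = a) :
  (C2_domain Omega -> is_open_ball Omega) /\
  (n = 2%N ->
     [/\ cut_locus Omega = high_ridge Omega,
         (exists p q : 'rV[R]_n, cut_locus Omega = line_segment p q)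
       & Omega = [set x | dist_to x (cut_locus Omega) < inradius Omega]]).
Proof.
have [c [ball_c touch]] := inner_ball.
have bdry_neq0 : bdry Omega !=set0.
  by have [p [_ [_ [_ [_ dp] _ _ _]]]] := touch; exists p.
have rho_gt0 : 0 < inradius Omega.
  have [x Ox] := Omega_neq0.
  apply: lt_le_trans (bdry_dist_gt0 Omega_open Omega_bounded bdry_neq0 Ox) _.
  by apply: le_inradius => //; exact: subset_closure.
have [w [w_rho dp dq]] := antipodal_touching rho_gt0 touch.
have reach := bdry_reaches_ridge Omega_open Omega_bounded bdry_neq0 Omega_sphere
  u_solution delta_gt0 u_C1 u_overdetermined rho_gt0 dp ball_c.
rewrite addrAC subrr add0r in reach; move/(_ w_rho) in reach.
have Mc := high_ridge_eball Omega_open Omega_bounded bdry_neq0 rho_gt0 ball_c.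
have M_perp z : high_ridge Omega z -> dot (z - c) w = 0.
  move=> Mz; apply/eqP; rewrite eq_le.
  rewrite (high_ridge_slab Omega_open Omega_convex rho_gt0 ball_c w_rho dp Mz) /=.
  rewrite -oppr_le0 -dotNr.
  apply: (high_ridge_slab Omega_open Omega_convex rho_gt0 ball_c _ dq Mz).
  by rewrite enormN.
have cutE := cut_locus_high_ridge Omega_open Omega_bounded Omega_convex bdry_neq0
  rho_gt0 reach.
split=> [C2|n2].
  exists c, (inradius Omega); split=> //; apply/seteqP; split=> // x.
  have Mz := C2_high_ridge Omega_open Omega_bounded Omega_convex bdry_neq0 rho_gt0 reach
    Mc w_rho M_perp C2.
  move=> /(high_ridge_near Omega_open Omega_bounded Omega_convex bdry_neq0 rho_gt0 reach).
  by move=> [z /Mz ->].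
subst n; rewrite cutE; split=> //; last first.
  exact: domain_high_ridge.
apply: (@planar_segment _ _ c w) => //.
- by rewrite -enorm_gt0 w_rho.
- exact: compact_high_ridge.
- by exists c.
- exact: high_ridge_convex.
Qed.
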